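(* There are algorithms which, given $n\ge5$ points $(X_1,Y_1),\dots,(X_n,Y_n)\in\mathbb R^2$ with $X_1,\dots,X_n$ pairwise distinct and $Y_1,\dots,Y_n$ pairwise distinct, compute exactly, in $O(n\log n)$ time, the Bergsma--Dassios--Yanagimoto statistic $\tau^\star=12T_n$ and the refined Hoeffding statistic $R_n$.
   Context: Cost model: comparing two input coordinates, and an arithmetic operation on numbers with $O(\log n)$ digits, each cost $O(1)$ time. The points induce the permutation $\pi\in S_n$ with $\pi(\mathrm{rank}\,X_i)=\mathrm{rank}\,Y_i$ for all $i$ (ranks among the $X$'s and among the $Y$'s, respectively). For $\sigma\in S_k$, $\#\sigma$ is the number of occurrences of the pattern $\sigma$ in $\pi$, i.e. the number of $x_1<\dots<x_k$ such that for all $i,j$: $\pi(x_i)<\pi(x_j)$ iff $\sigma(i)<\sigma(j)$. Statistic $T_n$: with $\mathcal C=\{1234,1243,2134,2143,3412,3421,4312,4321\}$ and $\mathcal D=S_4\setminus\mathcal C$ (one-line notation), $$T_n=\frac1{\binom n4}\left(\frac1{18}\sum_{\sigma\in\mathcal C}\#\sigma-\frac1{36}\sum_{\sigma\in\mathcal D}\#\sigma\right),\qquad \tau^\star=12T_n.$$ Statistic $R_n$: this is the U-statistic estimating $R=\iint (F-F_XF_Y)^2\,dF_X\,dF_Y$, where $F$ is a joint distribution function with continuous margins $F_X,F_Y$. Explicitly, $$R_n=\frac{1}{n(n-1)(n-2)(n-3)(n-4)}\sum_{i,j,k,l,m}\psi\big((X_i,Y_i),(X_j,Y_j),(X_k,Y_k),(X_l,Y_l),(X_m,Y_m)\big),$$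 the sum being over all ordered 5-tuples of distinct indices in $\{1,\dots,n\}$, where, with $I(\cdot)$ denoting the indicator of a condition, $$\psi\big((x_1,y_1),\dots,(x_5,y_5)\big)=I(x_1<x_4,\,y_1<y_5)\,I(x_2<x_4,\,y_2<y_5)-2\,I(x_1<x_4,\,y_1<y_5)\,I(x_2<x_4)\,I(y_3<y_5)+\tfrac19.$$ *)

(* Defs.v *)
From mathcomp Require Import all_boot all_order all_fingroup all_algebra.
From mathcomp Require Import reals.

Set Implicit Arguments.
Unset Strict Implicit.
Unset Printing Implicit Defensive.

Import Order.TTheory GRing.Theory Num.Theory.
Local Open Scope ring_scope.

(** * The statistics *)

(* Elements of {1, ..., n} are represented by 'I_n, so ranks start at 0. *)
Fact rank_subproof (R : realType) (n : nat) (Z : 'I_n -> R) (i : 'I_n) :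
  (#|[set j | (Z j < Z i)%R]| < n)%N.
Proof.
rewrite -[X in (_ < X)%N]card_ord; apply/proper_card/properP; split.
  exact/subsetP.
by exists i; rewrite // inE ltxx.
Qed.

Definition rank (R : realType) (n : nat) (Z : 'I_n -> R) (i : 'I_n) : 'I_n :=
  Ordinal (rank_subproof Z i).

Definition induced_perm (R : realType) (n : nat) (X Y : 'I_n -> R) : 'S_n :=
  odflt 1%g [pick p : 'S_n | [forall i, p (rank X i) == rank Y i]].

Lemma rank_inj (R : realType) (n : nat) (Z : 'I_n -> R) :
  injective Z -> injective (rank Z).
Proof.
move=> injZ.
have ltr i j : Z i < Z j -> (rank Z i < rank Z j)%N.
  move=> ltij; apply/proper_card/properP; split.
    by apply/subsetP => k; rewrite !inE => /lt_trans; apply.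
  by exists i; rewrite inE ?ltxx.
move=> i j eq_ij; apply: injZ; case: (ltgtP (Z i) (Z j)) => // /ltr;
  by rewrite eq_ij ltnn.
Qed.

(* The default value in [induced_perm] is never used for distinct coordinates;
   the permutation is unique because [rank X] is then bijective. *)
Lemma induced_permP (R : realType) (n : nat) (X Y : 'I_n -> R) :
  injective X -> injective Y ->
  forall i, induced_perm X Y (rank X i) = rank Y i.
Proof.
move=> /rank_inj injX /rank_inj injY; rewrite /induced_perm.
case: pickP => [p /forallP pP i | /(_ ((perm injX)^-1 * perm injY)%g)].
  exact/eqP.
move=> /negP[]; apply/forallP => i.
by rewrite permM -(permE injX) permK permE.
Qed.

Definition occurrences (k n : nat) (sigma : 'S_k) (p : 'S_n) : nat :=
  #|[set x : {ffun 'I_k -> 'I_n} |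
      [forall i : 'I_k, forall j : 'I_k, (i < j)%N ==> (x i < x j)%N] &&
      [forall i : 'I_k, forall j : 'I_k, (p (x i) < p (x j))%N == (sigma i < sigma j)%N]]|.

Definition one_line (k : nat) (sigma : 'S_k) : seq nat :=
  [seq (sigma i).+1 | i <- enum 'I_k].

Definition setC4 : {set 'S_4} :=
  [set sigma : 'S_4 | one_line sigma \in
    [:: [:: 1; 2; 3; 4]; [:: 1; 2; 4; 3]; [:: 2; 1; 3; 4]; [:: 2; 1; 4; 3];
        [:: 3; 4; 1; 2]; [:: 3; 4; 2; 1]; [:: 4; 3; 1; 2]; [:: 4; 3; 2; 1]]%N].

Definition setD4 : {set 'S_4} := ~: setC4.

Definition Tstat (R : realType) (n : nat) (X Y : 'I_n -> R) : R :=
  ('C(n, 4)%:R)^-1 *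
  (18%:R^-1 * \sum_(sigma in setC4) (occurrences sigma (induced_perm X Y))%:R
   - 36%:R^-1 *
       \sum_(sigma in setD4) (occurrences sigma (induced_perm X Y))%:R).

Definition tau_star (R : realType) (n : nat) (X Y : 'I_n -> R) : R :=
  12%:R * Tstat X Y.

Definition ind (R : realType) (b : bool) : R := b%:R.

Definition psi (R : realType) (z1 z2 z3 z4 z5 : R * R) : R :=
  let: (x1, y1) := z1 in let: (x2, y2) := z2 in let: (x3, y3) := z3 in
  let: (x4, y4) := z4 in let: (x5, y5) := z5 in
  ind R ((x1 < x4) && (y1 < y5)) * ind R ((x2 < x4) && (y2 < y5))
  - 2%:R * ind R ((x1 < x4) && (y1 < y5)) * ind R (x2 < x4) * ind R (y3 < y5)
  + 9%:R^-1.

Definition Rstat (R : realType) (n : nat) (X Y : 'I_n -> R) : R :=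
  ((n * (n - 1) * (n - 2) * (n - 3) * (n - 4))%N%:R)^-1 *
  \sum_(i < n) \sum_(j < n) \sum_(k < n) \sum_(l < n)
    \sum_(m < n | uniq [:: i; j; k; l; m])
      psi (X i, Y i) (X j, Y j) (X k, Y k) (X l, Y l) (X m, Y m).

(** * The machine model *)

(* Programs are finite texts of a While language with finitely many integer
   variables and integer arrays with random access.  The real coordinates are
   not data of the machine: a program can only test X_i < X_j and Y_i < Y_j,
   for indices i, j in {0, ..., n-1} that it has computed. *)

Inductive binop := Add | Sub | Mul | Quo | Rem | Lt | Eq.

Inductive expr :=
| Const of int
| Size                      (* the number n of input points *)
| Var of nat
| Get of nat & expr
| Bin of binop & expr & expr
| LtX of expr & expr
| LtY of expr & expr.

Inductive cmd :=
| Skip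
| Assign of nat & expr
| Put of nat & expr & expr  (* array, index, value *)
| Seq of cmd & cmd
| If of expr & cmd & cmd
| While of expr & cmd.

Record state := State { vars : nat -> int; arrs : nat -> int -> int }.

Definition init_state : state := State (fun _ => 0) (fun _ _ => 0).

Definition set_var (s : state) (x : nat) (v : int) : state :=
  State (fun y => if y == x then v else vars s y) (arrs s).

Definition set_arr (s : state) (a : nat) (i v : int) : state :=
  State (vars s)
    (fun b j => if (b == a) && (j == i) then v else arrs s b j).

Definition int_of_bool (b : bool) : int := if b then 1 else 0.

Definition eval_binop (o : binop) (u v : int) : int :=
  match o with
  | Add => u + v
  | Sub => u - v
  | Mul => u * v
  | Quo => (u %/ v)%Z
  | Rem => (u %% v)%Z
  | Lt => int_of_bool (u < v)
  | Eq => int_of_bool (u == v)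
  end.

Definition ndigits (v : int) : nat := (trunc_log 2 `|v|%N).+1.

Definition index_of (n : nat) (u : int) : option 'I_n :=
  if u is Posz k then insub k else None.

Definition compare_coord (R : realType) (n : nat) (Z : 'I_n -> R) (u v : int) :
    option int :=
  if (index_of n u, index_of n v) is (Some i, Some j)
  then Some (int_of_bool (Z i < Z j)) else None.

(* Evaluation fails as soon as some intermediate value has more than [w] binary
   digits, or an input index is out of range. *)
Fixpoint eval (w : nat) (R : realType) (n : nat) (X Y : 'I_n -> R) (s : state)
    (e : expr) : option int :=
  let res :=
    match e with
    | Const c => Some c
    | Size => Some n%:Z
    | Var x => Some (vars s x)
    | Get a e1 => omap (arrs s a) (eval w X Y s e1)
    | Bin o e1 e2 =>
        if (eval w X Y s e1, eval w X Y s e2) is (Some u, Some v)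
        then Some (eval_binop o u v) else None
    | LtX e1 e2 =>
        if (eval w X Y s e1, eval w X Y s e2) is (Some u, Some v)
        then compare_coord X u v else None
    | LtY e1 e2 =>
        if (eval w X Y s e1, eval w X Y s e2) is (Some u, Some v)
        then compare_coord Y u v else None
    end in
  if res is Some v then if (ndigits v <= w)%N then Some v else None else None.

(* Every node of an expression costs one unit of time. *)
Fixpoint cost (e : expr) : nat :=
  match e with
  | Const _ | Size | Var _ => 1
  | Get _ e1 => (cost e1).+1
  | Bin _ e1 e2 | LtX e1 e2 | LtY e1 e2 => (cost e1 + cost e2).+1
  end.

(* [exec w X Y c s t s']: started in [s], the program [c] halts in [s'] after
   time [t], without failing. *)
Inductive exec (w : nat) (R : realType) (n : nat) (X Y : 'I_n -> R) :
    cmd -> state -> nat -> state -> Prop :=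
| ExecSkip s : exec w X Y Skip s 1 s
| ExecAssign x e v s : eval w X Y s e = Some v ->
    exec w X Y (Assign x e) s (cost e).+1 (set_var s x v)
| ExecPut a e1 e2 i v s :
    eval w X Y s e1 = Some i -> eval w X Y s e2 = Some v ->
    exec w X Y (Put a e1 e2) s (cost e1 + cost e2).+1 (set_arr s a i v)
| ExecSeq c1 c2 s1 t1 s2 t2 s3 :
    exec w X Y c1 s1 t1 s2 -> exec w X Y c2 s2 t2 s3 ->
    exec w X Y (Seq c1 c2) s1 (t1 + t2) s3
| ExecIf e c1 c2 v s t s' : eval w X Y s e = Some v ->
    exec w X Y (if v == 0 then c2 else c1) s t s' ->
    exec w X Y (If e c1 c2) s (cost e + t).+1 s'
| ExecWhileEnd e c s : eval w X Y s e = Some 0 ->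
    exec w X Y (While e c) s (cost e).+1 s
| ExecWhileStep e c v s1 t1 s2 t2 s3 :
    eval w X Y s1 e = Some v -> v != 0 ->
    exec w X Y c s1 t1 s2 -> exec w X Y (While e c) s2 t2 s3 ->
    exec w X Y (While e c) s1 (cost e + t1 + t2).+1 s3.

Lemma exec_det (w : nat) (R : realType) (n : nat) (X Y : 'I_n -> R)
    c s t1 s1 t2 s2 :
  exec w X Y c s t1 s1 -> exec w X Y c s t2 s2 -> t1 = t2 /\ s1 = s2.
Proof.
move=> H; elim: H t2 s2 => {c s t1 s1}.
- by move=> s t2 s2 H; inversion H.
- by move=> x e v s ev t2 s2 H; inversion H; split=> //; congr set_var;
    congruence.
- by move=> a e1 e2 i v s ei ev t2 s2 H; inversion H; split=> //;
    congr set_arr; congruence.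
- move=> c1 c2 sa ta sb tb sc _ IH1 _ IH2 t2 s2 H.
  inversion H as [| | |? ? ? ? ? ? ? H1 H2| | |]; subst.
  by have [-> e] := IH1 _ _ H1; subst; have [-> ->] := IH2 _ _ H2.
- move=> e c1 c2 v s t s' ev _ IH t2 s2 H.
  inversion H as [| | | |? ? ? ? ? ? ? ev' H1| |]; subst.
  by move: ev' H1; rewrite ev => -[<-] /IH[-> ->].
- move=> e c s ev t2 s2 H.
  inversion H as [| | | | | |? ? ? ? ? ? ? ? ev' v0]; subst=> //.
  by move: ev' v0; rewrite ev => -[<-]; rewrite eqxx.
- move=> e c v sa ta sb tb sc ev v0 _ IH1 _ IH2 t2 s2 H.
  inversion H as [| | | | |? ? ? ev'|? ? ? ? ? ? ? ? ev' _ H1 H2]; subst.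
    by move: ev' v0; rewrite ev => -[->]; rewrite eqxx.
  by have [-> e1] := IH1 _ _ H1; subst; have [-> ->] := IH2 _ _ H2.
Qed.

(* The rational result is the quotient of the final values of the variables 0
   (numerator) and 1 (denominator). *)
Definition computes_within (w time : nat) (R : realType) (n : nat)
    (X Y : 'I_n -> R) (c : cmd) (r : R) : Prop :=
  exists (t : nat) (s : state),
    [/\ exec w X Y c init_state t s, (t <= time)%N, vars s 1%N != 0 &
        (vars s 0%N)%:~R / (vars s 1%N)%:~R = r].

(* Main.v *)
(* Let p be the permutation induced by the points, and for a position i let L
   and S be the number and the sum of the values p j < p i with j < i, and P the
   sum of all p j with j < i.  When a merge sort by value takes an element from
   the right block, the elements already taken from the left block are exactly
   its smaller predecessors in that block, so the sort yields L and S in time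
   O(n log n).  Both statistics are rational functions of n and of a sum over i
   of a polynomial in n, i, p i, L, S, P.

   For tau*, write the four comparisons between {a, b} and {c, d}, for a < b < c
   < d, as a 2 x 2 matrix of bits. It cannot be a permutation matrix, hence
   concordance (all bits equal) is a polynomial of degree 2 in the bits in which
   only products of two bits in the same row or column occur. The products (p a
   < p c)(p a < p d) and (p a < p d)(p b < p d) are not counts around a single
   point; they are obtained by counting pairs c < d together with a position l <
   c and a value p m below p c and p d, and inserting m among l < c < d.

   For R, fix the indices l and m of the two thresholds and sum over the other
   three points first; what remains is a combination of sums over pairs. *)
Require Import Defs.
From mathcomp Require Import all_boot all_order all_fingroup all_algebra.
From mathcomp Require Import reals zify ring.

Set Implicit Arguments.
Unset Strict Implicit.
Unset Printing Implicit Defensive.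

Import Order.TTheory GRing.Theory Num.Theory.
Local Open Scope ring_scope.

(** * Evaluation and running time *)

Section Machine.
Variables (R : realType) (n : nat) (X Y : 'I_n -> R).
Hypothesis n_gt1 : (1 < n)%N.

(** Evaluation fails on any intermediate value that is too long, so besides correctness every node
    of every expression needs a size bound. Values are bounded by powers of [n], with exponents read
    off the program text by [deg] and [deg_cmd]. Because [n] is at least 2, an addition costs one
    exponent and a constant costs its number of digits, so each check becomes an inequality between
    closed numerals, decided by computation; 200 dominates all exponents that occur, and words of
    [400 * trunc_log 2 n] bits hold [n ^ 200]. This analysis covers loop-free code only. Loops are
    handled by invariants, which keep the state within a fixed environment, and by a potential:
    merging a block uses up its length, a level of the sort uses up [n]. The counts are taken
    doubled, so that binomial coefficients of degree two become integer polynomials and the programs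
    never divide. *)

Definition compare_total (Z : 'I_n -> R) (u v : int) : int :=
  odflt 0 (compare_coord Z u v).

Fixpoint ev (s : state) (e : expr) : int :=
  match e with
  | Const c => c
  | Size => n%:Z
  | Var x => vars s x
  | Get a e1 => arrs s a (ev s e1)
  | Bin o e1 e2 => eval_binop o (ev s e1) (ev s e2)
  | LtX e1 e2 => compare_total X (ev s e1) (ev s e2)
  | LtY e1 e2 => compare_total Y (ev s e1) (ev s e2)
  end.

Fixpoint safe (s : state) (e : expr) : bool :=
  match e with
  | Const _ | Size | Var _ => true
  | Get _ e1 => safe s e1
  | Bin o e1 e2 =>
      [&& safe s e1, safe s e2 & if o is (Quo | Rem) then false else true]
  | LtX e1 e2 | LtY e1 e2 =>
      [&& safe s e1, safe s e2, index_of n (ev s e1) != None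
        & index_of n (ev s e2) != None]
  end.

(* Sizes are tracked as exponents: an entry [d] stands for the bound [n ^ d]. *)
Record env := Env { evars : nat -> nat; earrs : nat -> nat }.

Definition bounded (E : env) (s : state) : Prop :=
  (forall x, `|vars s x| <= n ^ evars E x)%N /\
  (forall a i, `|arrs s a i| <= n ^ earrs E a)%N.

(** The exponent of a node is at least that of each child, so a bound at the root covers all
    intermediate values that [eval] checks. *)
Fixpoint deg (E : env) (e : expr) : nat :=
  match e with
  | Const c => ndigits c
  | Size => 1
  | Var x => evars E x
  | Get a e1 => maxn (earrs E a) (deg E e1)
  | Bin Mul e1 e2 => deg E e1 + deg E e2
  | Bin (Add | Defs.Sub) e1 e2 => (maxn (deg E e1) (deg E e2)).+1
  | Bin _ e1 e2 | LtX e1 e2 | LtY e1 e2 => maxn (deg E e1) (deg E e2)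
  end.

Lemma ev_bounded E s e : bounded E s -> safe s e -> (`|ev s e| <= n ^ deg E e)%N.
Proof.
move=> [bv ba].
have pow_gt0 d : (0 < n ^ d)%N by rewrite expn_gt0 (ltn_trans _ n_gt1).
have le_max a b c : (c <= n ^ a -> c <= n ^ maxn a b)%N.
  by move=> /leq_trans; apply; rewrite leq_pexp2l ?leq_maxl // ltnW.
have le_max' a b c : (c <= n ^ b -> c <= n ^ maxn a b)%N.
  by rewrite maxnC; exact: le_max.
have bool_le b d : (`|int_of_bool b| <= n ^ d)%N.
  by rewrite /int_of_bool; case: b => /=.
elim: e => [c||x|a e1 IH1|o e1 IH1 e2 IH2|e1 IH1 e2 IH2|e1 IH1 e2 IH2] /=.
- move=> _; apply: leq_trans (_ : 2 ^ ndigits c <= _)%N.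
    by rewrite /ndigits ltnW // trunc_log_ltn.
  by rewrite leq_exp2r // /ndigits.
- by rewrite expn1.
- by move=> _; exact: bv.
- by move=> _; apply: le_max; exact: ba.
- move=> /and3P[/IH1 {}IH1 /IH2 {}IH2].
  have addB (u v : int) a b : (`|u| <= n ^ a)%N -> (`|v| <= n ^ b)%N ->
    (`|u| + `|v| <= n ^ (maxn a b).+1)%N.
    move=> /(le_max _ b) hu /(le_max' a) hv; rewrite expnS.
    by have := leq_add hu hv; rewrite addnn -mul2n => /leq_trans; apply;
      rewrite leq_mul2r n_gt1 orbT.
  case: o => //= _.
  + by apply: leq_trans (addB _ _ _ _ IH1 IH2); lia.
  + by apply: leq_trans (addB _ _ _ _ IH1 IH2); lia.
  + by rewrite abszM expnD leq_mul.
- move=> _; rewrite /compare_total /compare_coord.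
  by case: (index_of n (ev s e1)) => [i|]; case: (index_of n (ev s e2)) => [j|] //=;
    exact: bool_le.
- move=> _; rewrite /compare_total /compare_coord.
  by case: (index_of n (ev s e1)) => [i|]; case: (index_of n (ev s e2)) => [j|] //=;
    exact: bool_le.
Qed.

Section Width.
Variable w : nat.

Lemma ndigits_le d v : (n ^ d < 2 ^ w)%N -> (`|v| <= n ^ d)%N -> (ndigits v <= w)%N.
Proof.
move=> hd hv; rewrite /ndigits.
have w_gt0 : (0 < w)%N.
  by case: w hd => //; rewrite ltnS leqn0 expn_eq0 => /andP[/eqP n0]; move: n_gt1; rewrite n0.
have [->|v0] := eqVneq v 0; first by rewrite absz0 trunc_log0.
rewrite -(ltn_exp2l _ _ (ltnSn 1)).
by apply: leq_ltn_trans (leq_ltn_trans hv hd); rewrite trunc_logP // absz_gt0.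
Qed.

Lemma eval_safe E s e : bounded E s -> safe s e -> (n ^ deg E e < 2 ^ w)%N ->
  eval w X Y s e = Some (ev s e).
Proof.
move=> bE.
have lt_le a b : (a <= b)%N -> (n ^ b < 2 ^ w)%N -> (n ^ a < 2 ^ w)%N.
  by move=> ab; apply: leq_ltn_trans; rewrite leq_pexp2l // ltnW.
have lt_max a b : (n ^ maxn a b < 2 ^ w)%N ->
    (n ^ a < 2 ^ w)%N /\ (n ^ b < 2 ^ w)%N.
  by move=> h; split; apply: lt_le h; rewrite ?leq_maxl ?leq_maxr.
have lt_maxS a b : (n ^ (maxn a b).+1 < 2 ^ w)%N ->
    (n ^ a < 2 ^ w)%N /\ (n ^ b < 2 ^ w)%N.
  by move=> h; apply: lt_max; apply: lt_le h.
have lt_add a b : (n ^ (a + b) < 2 ^ w)%N ->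
    (n ^ a < 2 ^ w)%N /\ (n ^ b < 2 ^ w)%N.
  by move=> h; split; apply: lt_le h; rewrite ?leq_addl ?leq_addr.
elim: e => [c||x|a e1 IH1|o e1 IH1 e2 IH2|e1 IH1 e2 IH2|e1 IH1 e2 IH2] se he.
all: have hn := ndigits_le he (ev_bounded bE se).
- by move: hn; rewrite /= => ->.
- by move: hn; rewrite /= => ->.
- by move: hn; rewrite /= => ->.
- move: hn; rewrite /= IH1 //=; first by move=> ->.
  by move: he => /= /lt_max[].
- move: hn; move: se he => /= /and3P[s1 s2 _] he.
  have [h1 h2] : (n ^ deg E e1 < 2 ^ w)%N /\ (n ^ deg E e2 < 2 ^ w)%N.
    by case: o he => /=; auto.
  by rewrite IH1 // IH2 //= => ->.
- move: hn; move: se he => /= /and4P[s1 s2 i1 i2] /lt_max[h1 h2].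
  rewrite IH1 // IH2 //= /compare_total /compare_coord.
  by case: index_of i1 => [i|] // _; case: index_of i2 => [j|] //= _ ->.
- move: hn; move: se he => /= /and4P[s1 s2 i1 i2] /lt_max[h1 h2].
  rewrite IH1 // IH2 //= /compare_total /compare_coord.
  by case: index_of i1 => [i|] // _; case: index_of i2 => [j|] //= _ ->.
Qed.

(** * Loop-free commands: effect, size and cost *)

Fixpoint loop_free (c : cmd) : bool :=
  match c with
  | Seq c1 c2 | If _ c1 c2 => loop_free c1 && loop_free c2
  | While _ _ => false
  | _ => true
  end.

(** [While] gets a dummy value here and in [safe_cmd], [env_cmd], [deg_cmd] and [worst]; [run_exec]
    is stated for loop-free commands only. *)
Fixpoint run (c : cmd) (s : state) : state :=
  match c with
  | Skip | While _ _ => s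
  | Assign x e => set_var s x (ev s e)
  | Put a e1 e2 => set_arr s a (ev s e1) (ev s e2)
  | Seq c1 c2 => run c2 (run c1 s)
  | If e c1 c2 => if ev s e == 0 then run c2 s else run c1 s
  end.

Fixpoint safe_cmd (c : cmd) (s : state) : bool :=
  match c with
  | Skip | While _ _ => true
  | Assign x e => safe s e
  | Put a e1 e2 => safe s e1 && safe s e2
  | Seq c1 c2 => safe_cmd c1 s && safe_cmd c2 (run c1 s)
  | If e c1 c2 => safe s e && if ev s e == 0 then safe_cmd c2 s else safe_cmd c1 s
  end.

Definition upd (f : nat -> nat) (x d : nat) : nat -> nat :=
  fun y => if y == x then d else f y.

Definition env_max (E1 E2 : env) : env :=
  Env (fun x => maxn (evars E1 x) (evars E2 x))
      (fun a => maxn (earrs E1 a) (earrs E2 a)).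

(** A write leaves the other cells of the array in place, so the array keeps the larger exponent,
    whereas an assignment replaces the exponent of its variable. *)
Fixpoint env_cmd (E : env) (c : cmd) : env :=
  match c with
  | Skip | While _ _ => E
  | Assign x e => Env (upd (evars E) x (deg E e)) (earrs E)
  | Put a e1 e2 =>
      Env (evars E) (upd (earrs E) a (maxn (earrs E a) (deg E e2)))
  | Seq c1 c2 => env_cmd (env_cmd E c1) c2
  | If e c1 c2 => env_max (env_cmd E c1) (env_cmd E c2)
  end.

Fixpoint deg_cmd (E : env) (c : cmd) : nat :=
  match c with
  | Skip | While _ _ => 0
  | Assign x e => deg E e
  | Put a e1 e2 => maxn (deg E e1) (deg E e2)
  | Seq c1 c2 => maxn (deg_cmd E c1) (deg_cmd (env_cmd E c1) c2)
  | If e c1 c2 => maxn (deg E e) (maxn (deg_cmd E c1) (deg_cmd E c2))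
  end.

Fixpoint worst (c : cmd) : nat :=
  match c with
  | Skip | While _ _ => 1
  | Assign x e => (cost e).+1
  | Put a e1 e2 => (cost e1 + cost e2).+1
  | Seq c1 c2 => worst c1 + worst c2
  | If e c1 c2 => (cost e + (worst c1 + worst c2)).+1
  end.

Lemma bounded_set_var E s x v d :
  bounded E s -> (`|v| <= n ^ d)%N ->
  bounded (Env (upd (evars E) x d) (earrs E)) (set_var s x v).
Proof. by move=> [bv ba] hv; split=> //= y; rewrite /upd; case: eqP. Qed.

Lemma leq_pow d d' v : (d <= d')%N -> (v <= n ^ d)%N -> (v <= n ^ d')%N.
Proof. by move=> dd /leq_trans; apply; rewrite leq_pexp2l // ltnW. Qed.

Lemma run_exec E c s :
  loop_free c -> bounded E s -> safe_cmd c s -> (n ^ deg_cmd E c < 2 ^ w)%N ->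
  bounded (env_cmd E c) (run c s) /\
  exists2 t, exec w X Y c s t (run c s) & (t <= worst c)%N.
Proof.
have lt_max a b : (n ^ maxn a b < 2 ^ w)%N -> (n ^ a < 2 ^ w)%N /\ (n ^ b < 2 ^ w)%N.
  by move=> h; split; apply: leq_ltn_trans h; rewrite leq_pexp2l ?leq_maxl ?leq_maxr // ltnW.
elim: c E s => //= [|x e|a e1 e2|c1 IH1 c2 IH2|e c1 IH1 c2 IH2] E s.
- by move=> _ bE _ _; split=> //; exists 1%N => //; exact: ExecSkip.
- move=> _ bE se he; split; first exact/bounded_set_var/ev_bounded.
  exists (cost e).+1 => //; apply: ExecAssign; exact: eval_safe he.
- move=> _ bE /andP[s1 s2] /lt_max[h1 h2]; split.
    have [bv ba] := bE; split=> //= b i; rewrite /upd; case: eqP => /= [->|_].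
      case: eqP => _; last by apply: leq_pow (ba _ _); rewrite leq_maxl.
      by apply: leq_pow (ev_bounded bE s2); rewrite leq_maxr.
    exact: ba.
  exists (cost e1 + cost e2).+1 => //.
  by apply: ExecPut; [exact: eval_safe h1 | exact: eval_safe h2].
- move=> /andP[l1 l2] bE /andP[s1 s2] /lt_max[h1 h2].
  have [b1 [t1 x1 ht1]] := IH1 _ _ l1 bE s1 h1.
  have [b2 [t2 x2 ht2]] := IH2 _ _ l2 b1 s2 h2.
  split=> //; exists (t1 + t2)%N; first exact: ExecSeq x1 x2.
  exact: leq_add.
- move=> /andP[l1 l2] bE /andP[se sc] /lt_max[he /lt_max[h1 h2]].
  have bmax E1 E2 s' : bounded E1 s' \/ bounded E2 s' -> bounded (env_max E1 E2) s'.
    move=> [] [bv ba]; split=> [z|b i] /=.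
    - by apply: leq_pow (bv z); rewrite leq_maxl.
    - by apply: leq_pow (ba b i); rewrite leq_maxl.
    - by apply: leq_pow (bv z); rewrite leq_maxr.
    - by apply: leq_pow (ba b i); rewrite leq_maxr.
  have hev := eval_safe bE se he.
  have [e0|e0] := eqVneq (ev s e) 0.
    rewrite e0 eqxx in sc *.
    have [b2 [t2 x2 ht2]] := IH2 _ _ l2 bE sc h2.
    split; first by apply: bmax; right.
    exists (cost e + t2).+1; last by lia.
    by apply: (ExecIf hev); rewrite e0 eqxx.
  rewrite (negPf e0) in sc.
  have [b1 [t1 x1 ht1]] := IH1 _ _ l1 bE sc h1.
  split; first by apply: bmax; left.
  exists (cost e + t1).+1; last by lia.
  by apply: (ExecIf hev); rewrite (negPf e0).
Qed.

(** * Termination within a time bound *)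

Definition terminates (c : cmd) (s : state) (T : nat) (Q : state -> Prop) : Prop :=
  exists t s', [/\ exec w X Y c s t s', (t <= T)%N & Q s'].

Lemma terminates_seq c1 c2 s T1 T2 (Q1 Q2 : state -> Prop) :
  terminates c1 s T1 Q1 -> (forall s', Q1 s' -> terminates c2 s' T2 Q2) ->
  terminates (Seq c1 c2) s (T1 + T2) Q2.
Proof.
move=> [t1 [s1 [x1 h1 q1]]] /(_ _ q1)[t2 [s2 [x2 h2 q2]]].
by exists (t1 + t2)%N, s2; split=> //; [exact: ExecSeq x1 x2 | exact: leq_add].
Qed.

Lemma terminates_run E c s (Q : state -> Prop) :
  loop_free c -> (n ^ deg_cmd E c < 2 ^ w)%N -> bounded E s -> safe_cmd c s ->
  Q (run c s) -> terminates c s (worst c) Q.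
Proof.
move=> lc hc bE sc q; have [_ [t x ht]] := run_exec lc bE sc hc.
by exists t, (run c s).
Qed.

Lemma terminates_weaken c s T T' (Q Q' : state -> Prop) :
  terminates c s T Q -> (T <= T')%N -> (forall s', Q s' -> Q' s') ->
  terminates c s T' Q'.
Proof.
move=> [t [s' [x h q]]] hT hQ; exists t, s'; split=> //; last exact: hQ.
exact: leq_trans hT.
Qed.

(* The index [k] of the invariant is a potential that pays for the iterations. *)
Lemma terminates_while (I : nat -> state -> Prop) E e c C (Q : state -> Prop) :
  (n ^ deg E e < 2 ^ w)%N ->
  (forall k s, I k s -> [/\ bounded E s, safe s e, ev s e = 0 -> Q s &
     ev s e != 0 -> exists d, [/\ (0 < d)%N, (d <= k)%N &
       terminates c s (C * d) (I (k - d)%N)]]) ->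
  forall k s, I k s ->
  terminates (While e c) s ((C + (cost e).+1) * k + (cost e).+1) Q.
Proof.
move=> he step; elim/ltn_ind => k IH s Iks.
have [bE se hQ hstep] := step _ _ Iks.
have hev := eval_safe bE se he.
have [e0|e0] := eqVneq (ev s e) 0.
  exists (cost e).+1, s; split; last exact: hQ.
    by apply: ExecWhileEnd; rewrite hev e0.
  by rewrite leq_addl.
have [d [d0 dk [t1 [s1 [x1 h1 q1]]]]] := hstep e0.
have [|t2 [s2 [x2 h2 q2]]] := IH (k - d)%N _ _ q1; first by lia.
exists (cost e + t1 + t2).+1, s2; split=> //.
  exact: ExecWhileStep hev e0 x1 x2.
have -> : k = (d + (k - d))%N by lia.
rewrite mulnDr mulnDl.
(* The drop [d] is positive, so it also pays for one evaluation of the guard. *)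
have : ((cost e).+1 <= (cost e).+1 * d)%N by rewrite leq_pmulr.
lia.
Qed.

Definition For (x : nat) (c : cmd) : cmd :=
  Seq (Assign x (Const 0))
    (While (Bin Defs.Lt (Var x) Size)
       (Seq c (Assign x (Bin Add (Var x) (Const 1))))).

Lemma terminates_for (I : nat -> state -> Prop) E x c s :
  let body := Seq c (Assign x (Bin Add (Var x) (Const 1))) in
  (n ^ deg E (Bin Defs.Lt (Var x) Size) < 2 ^ w)%N ->
  (n ^ deg_cmd E body < 2 ^ w)%N -> loop_free c ->
  bounded E s -> I 0%N (set_var s x 0) ->
  (forall i s', I i s' -> bounded E s' /\ vars s' x = i%:Z) ->
  (forall i s', (i < n)%N -> I i s' ->
     safe_cmd body s' /\ I i.+1 (run body s')) ->
  terminates (For x c) s (2 + ((worst body + 4) * n + 4)) (I n).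
Proof.
move=> body he hc lc bE I0 hI step.
apply: (@terminates_seq _ _ _ _ _ (I 0%N)).
  apply: (terminates_run (E := E)) => //=.
  apply: leq_ltn_trans he; rewrite leq_pexp2l //; first by rewrite ltnW.
  by rewrite /= leq_max /ndigits /= trunc_log0 orbT.
move=> s1 I1.
pose J k s' := (k <= n)%N /\ I (n - k)%N s'.
apply: (terminates_weaken (T := ((worst body + 4) * n + 4)) (Q := I n)) => //.
apply: (@terminates_while J E) => //; last by split; rewrite ?subnn.
move=> k s' [kn Is']; have [bE' vx] := hI _ _ Is'.
split=> //=; rewrite vx ltz_nat.
  by rewrite /int_of_bool; case: ifP => // h _; have -> : n = (n - k)%N by lia.
rewrite /int_of_bool; case: ifP => // h _.
exists 1%N; split=> //; first by lia.
rewrite muln1; have [sb Ib] := step _ _ h Is'.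
apply: (terminates_run (E := E)) => //; first by rewrite /= lc.
split; first by lia.
by have -> : (n - (k - 1) = (n - k).+1)%N by lia.
Qed.

End Width.
End Machine.

(** * Counting below a threshold *)

Section Counting.
Local Open Scope nat_scope.
Variables (n : nat) (key : nat -> nat).
Hypothesis key_inj : forall e e', e < n -> e' < n -> key e = key e' -> e = e'.

Definition below (f : nat -> nat) (lo hi t : nat) : nat :=
  \sum_(lo <= e < hi | key e < t) f e.
Local Notation cnt := (below (fun _ => 1)).

Lemma below_split f lo hi t t' : t <= t' ->
  below f lo hi t' = below f lo hi t + \sum_(lo <= e < hi | t <= key e < t') f e.
Proof.
move=> tt'; rewrite /below (bigID (fun e => key e < t)) /=; congr (_ + _);
  apply: eq_bigl => e; lia.
Qed.

Lemma below_mono f lo hi t t' : t <= t' -> below f lo hi t <= below f lo hi t'.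
Proof. by move=> /(below_split f lo hi) ->; rewrite leq_addr. Qed.

Lemma below_cat f lo mid hi t : lo <= mid -> mid <= hi ->
  below f lo hi t = below f lo mid t + below f mid hi t.
Proof. by move=> h1 h2; rewrite /below (big_cat_nat h1 h2). Qed.

Lemma cnt_le lo hi t : cnt lo hi t <= hi - lo.
Proof. by rewrite /below sum1_count (leq_trans (count_size _ _)) // size_iota. Qed.

Lemma cnt_sep lo hi t t' e : lo <= e < hi -> t <= key e < t' ->
  cnt lo hi t < cnt lo hi t'.
Proof.
move=> he ht; rewrite (@below_split _ lo hi t t'); last by lia.
rewrite -[X in X < _]addn0 ltn_add2l sum1_count -has_count.
by apply/hasP; exists e => //; rewrite mem_index_iota.
Qed.

(** Equal counts leave no key of the block between the two thresholds, by [cnt_sep]. Positions of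
    the merge are counts, so this converts positions back into statements on keys. *)
Lemma cnt_eq_key lo hi t t' e : cnt lo hi t = cnt lo hi t' -> lo <= e < hi ->
  (key e < t) = (key e < t').
Proof.
wlog tt' : t t' / t <= t' => [hw|] ct he.
  by case: (leqP t t') => [|/ltnW] h; [|apply/esym]; apply: hw.
apply/idP/idP => h; first exact: leq_trans tt'.
by rewrite ltnNge; apply/negP => h'; have := @cnt_sep lo hi t t' e he;
   rewrite h h' ct ltnn => /(_ isT).
Qed.

Lemma cnt_eq_below f lo hi t t' : cnt lo hi t = cnt lo hi t' ->
  below f lo hi t = below f lo hi t'.
Proof.
move=> ct; rewrite /below big_seq_cond [RHS]big_seq_cond.
apply: eq_bigl => e; rewrite mem_index_iota; case: (boolP (_ <= e < _)) => //= he.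
exact: cnt_eq_key ct he.
Qed.

Lemma below_key f lo hi e : lo <= e < hi -> hi <= n ->
  below f lo hi (key e).+1 = below f lo hi (key e) + f e.
Proof.
move=> he hn; rewrite (@below_split _ _ _ (key e)) //; congr (_ + _).
rewrite big_mkcond (bigD1_seq e) /= ?iota_uniq ?mem_index_iota ?leqnn ?ltnSn //.
rewrite big_seq_cond big1 ?addn0 // => e'.
rewrite mem_index_iota => /andP[he' /eqP ne]; case: ifP => // hk; case: ne.
by apply: key_inj; lia.
Qed.

Lemma cnt_full lo hi t e : cnt lo hi t = hi - lo -> lo <= e < hi -> key e < t.
Proof.
move=> ct he; rewrite ltnNge; apply/negP => h.
have := @cnt_sep lo hi t (key e).+1 e he; rewrite h ltnSn ct => /(_ isT).
by rewrite ltnNge cnt_le.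
Qed.

(* [t] is the threshold of a merge: the elements already taken are those with
   key below [t], and [e] is the next element of its own block. *)
Lemma merge_pick lo hi lo' hi' t e : lo <= e < hi ->
  cnt lo hi (key e) = cnt lo hi t ->
  cnt lo' hi' t = hi' - lo' \/
    (exists2 e', cnt lo' hi' (key e') = cnt lo' hi' t & key e < key e') ->
  [/\ t <= key e, cnt lo' hi' (key e) = cnt lo' hi' t &
      cnt lo' hi' (key e).+1 = cnt lo' hi' t].
Proof.
move=> he ce other.
have te : t <= key e.
  rewrite leqNgt; apply/negP => h; have := @cnt_sep lo hi (key e) t e he.
  by rewrite leqnn h ce ltnn => /(_ isT).
have h1 : cnt lo' hi' t <= cnt lo' hi' (key e) by exact: below_mono.
have h2 : cnt lo' hi' (key e) <= cnt lo' hi' (key e).+1 by exact: below_mono.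
have h3 : cnt lo' hi' (key e).+1 <= cnt lo' hi' t.
  case: other => [->|[e' <- h]]; [exact: cnt_le | exact: below_mono].
by split=> //; lia.
Qed.

End Counting.

(** * Merging two sorted blocks *)

Local Notation "a +' b" := (Bin Add a b) (at level 50, left associativity).
Local Notation "a -' b" := (Bin Defs.Sub a b) (at level 50, left associativity).
Local Notation "a *' b" := (Bin Mul a b) (at level 40, left associativity).
Local Notation "a <' b" := (Bin Defs.Lt a b) (at level 70).
Local Notation "c1 ;; c2" := (Seq c1 c2) (at level 80, right associativity).

(* Variables: 2 is the counter of the for loops; 3, 4, 5 delimit the blocks
   [3, 4) and [4, 5) to be merged, 6 and 7 are the reading positions, 8 is the
   total weight taken from the left block, 9 is the block width, 10 and 11 are
   the two candidates, 13 is the result of their comparison; 12 and 14 hold the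
   running sums of the summands and of the ranks of the ordinates.
   Arrays: 0 current order, 1 merged order, 2 number and 3 total weight of the
   smaller predecessors, 4 weights, 5 the points ordered by abscissa. *)
Definition compare (b : bool) : expr :=
  if b then LtX (Var 10) (Var 11)
  else LtY (Get 5 (Var 10)) (Get 5 (Var 11)).

Definition merge_choice (b : bool) : cmd :=
  Assign 10 (Get 0 (Var 6)) ;; Assign 11 (Get 0 (Var 7)) ;;
  If (Var 6 <' Var 4)
    (If (Var 7 <' Var 5) (Assign 13 (compare b)) (Assign 13 (Const 1)))
    (Assign 13 (Const 0)).

Definition take_left : cmd :=
  Put 1 (Var 6 +' Var 7 -' Var 4) (Var 10) ;;
  Assign 8 (Var 8 +' Get 4 (Var 10)) ;; Assign 6 (Var 6 +' Const 1).

Definition take_right : cmd :=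
  Put 1 (Var 6 +' Var 7 -' Var 4) (Var 11) ;;
  Put 2 (Var 11) (Get 2 (Var 11) +' (Var 6 -' Var 3)) ;;
  Put 3 (Var 11) (Get 3 (Var 11) +' Var 8) ;; Assign 7 (Var 7 +' Const 1).

Definition merge_step (b : bool) : cmd :=
  merge_choice b ;; If (Var 13) take_left take_right.

Definition merge_guard : expr := Var 6 +' Var 7 <' Var 4 +' Var 5.

(* Indices and sums of at most n ranks stay below n ^ 3; variable 12 sums n
   summands, each of which is bounded by n ^ 59. *)
Definition sort_env : env := Env (fun x => if x == 12%N then 60 else 3) (fun _ => 3).

Section Sort.
Variables (R : realType) (n : nat) (X Y : 'I_n -> R).
Hypothesis n_gt1 : (1 < n)%N.
Variable w : nat.
Hypothesis small_exp : forall d, (d <= 200)%N -> (n ^ d < 2 ^ w)%N.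

Local Notation bnd := (bounded n sort_env).

Lemma run_seq c1 c2 s : run X Y (c1 ;; c2) s = run X Y c2 (run X Y c1 s).
Proof. by []. Qed.

Lemma safe_seq c1 c2 s :
  safe_cmd X Y (c1 ;; c2) s = safe_cmd X Y c1 s && safe_cmd X Y c2 (run X Y c1 s).
Proof. by []. Qed.

Lemma bounded_var s x v : bnd s -> x != 12%N -> (`|v| <= n ^ 3)%N -> bnd (set_var s x v).
Proof.
move=> [bv ba] x12 hv; split=> //= y; case: eqP => [->|_]; last exact: bv.
by rewrite (negPf x12).
Qed.

Lemma bounded_arr s a i v : bnd s -> (`|v| <= n ^ 3)%N -> bnd (set_arr s a i v).
Proof. by move=> [bv ba] hv; split=> //= b j; case: ifP. Qed.

Lemma small_cst v : (v <= 4 * n)%N -> (v <= n ^ 3)%N.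
Proof. by move: n_gt1; case: n => [|[|[|k]]] // _; rewrite ?expnS ?expn0; nia. Qed.

Lemma small_sq v : (v <= 2 * n ^ 2)%N -> (v <= n ^ 3)%N.
Proof. by move: n_gt1 => h; rewrite !expnS !expn0; nia. Qed.

Variables (b : bool) (key wt : nat -> nat) (WT PA : int -> int).
Hypothesis key_inj : forall e e', (e < n)%N -> (e' < n)%N -> key e = key e' -> e = e'.
Hypothesis compareP : forall s e e', (e < n)%N -> (e' < n)%N ->
  arrs s 5 = PA -> vars s 10 = e%:Z -> vars s 11 = e'%:Z ->
  safe X Y s (compare b) /\ ev X Y s (compare b) = int_of_bool (key e < key e')%N.
Hypothesis WTP : forall e, (e < n)%N -> WT e%:Z = wt e /\ (wt e <= n)%N.

Local Notation cnt := (below key (fun _ => 1%N)).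
Local Notation wsum := (below key wt).

Lemma wsum_le lo hi t : (hi <= n)%N -> (wsum lo hi t <= n ^ 2)%N.
Proof.
move=> hin; apply: (@leq_trans (\sum_(lo <= e < hi | (key e < t)%N) n)%N).
  rewrite /below big_seq_cond [X in (_ <= X)%N]big_seq_cond.
  apply: leq_sum => e /andP[]; rewrite mem_index_iota => he _.
  by apply: (WTP _).2; lia.
rewrite big_mkcond; apply: (@leq_trans (\sum_(lo <= e < hi) n)%N).
  by apply: leq_sum => e _; case: ifP.
by rewrite sum_nat_const_nat expnS expn1 leq_mul2r; apply/orP; right; lia.
Qed.

(* Elements are named by their initial positions, so that the entries of a block
   of the array are always the elements of the same interval. *)
Definition sorted_block (A : int -> int) (lo hi : nat) : Prop :=
  forall p, (lo <= p < hi)%N ->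
  exists2 e : nat, A p%:Z = e%:Z & (lo <= e < hi)%N /\ (lo + cnt lo hi (key e))%N = p.

Section Merge.
Variables (s m h : nat) (width : int) (A0 B0 : int -> int) (L0 S0 : nat -> nat).
Hypothesis smh : [/\ s <= m, m <= h & h <= n]%N.
Hypothesis sorted_left : sorted_block A0 s m.
Hypothesis sorted_right : sorted_block A0 m h.
Hypothesis L0_le : forall e, (e < n)%N -> (L0 e <= n)%N.
Hypothesis S0_le : forall e, (e < n)%N -> (S0 e <= n ^ 2)%N.

(** The threshold [t] alone determines the progress: [i], [j] and the array contents are functions
    of it. The number [k] of elements still to be taken is the potential of the loop. Outside the
    two blocks the output array must stay equal to [B0], which holds the blocks merged earlier. *)
Record merging (t i j k : nat) (st : state) : Prop := Merging {
  mg_bnd : bnd st;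
  mg_s : vars st 3 = s%:Z; mg_m : vars st 4 = m%:Z; mg_h : vars st 5 = h%:Z;
  mg_i : vars st 6 = i%:Z; mg_j : vars st 7 = j%:Z;
  mg_sum : vars st 8 = (wsum s m t)%:Z; mg_w : vars st 9 = width;
  mg_A : arrs st 0 = A0; mg_WT : arrs st 4 = WT; mg_PA : arrs st 5 = PA;
  mg_it : i = (s + cnt s m t)%N; mg_jt : j = (m + cnt m h t)%N;
  mg_k : (k + (i + j) = m + h)%N;
  mg_B : forall p, (s <= p < i + j - m)%N ->
    exists2 e : nat, arrs st 1 p%:Z = e%:Z & (s <= e < h)%N /\ (s + cnt s h (key e))%N = p;
  mg_B0 : forall p : nat, ~~ (s <= p < h)%N -> arrs st 1 p%:Z = B0 p%:Z;
  mg_L : forall e : nat, (e < n)%N -> arrs st 2 e%:Z =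
    (L0 e + (if (m <= e < h)%N && (key e < t)%N then cnt s m (key e) else 0))%N;
  mg_S : forall e : nat, (e < n)%N -> arrs st 3 e%:Z =
    (S0 e + (if (m <= e < h)%N && (key e < t)%N then wsum s m (key e) else 0))%N }.

Lemma take_leftP t i j k e st0 st :
  merging t i j k st0 -> (i < m)%N -> A0 i%:Z = e%:Z -> (s <= e < m)%N ->
  (s + cnt s m (key e))%N = i ->
  cnt m h t = (h - m)%N \/
    (exists2 e', cnt m h (key e') = cnt m h t & (key e < key e')%N) ->
  bnd st -> vars st 10 = e%:Z -> (forall x, (x < 10)%N -> vars st x = vars st0 x) ->
  arrs st = arrs st0 ->
  safe_cmd X Y take_left st /\
  exists t' i' j', merging t' i' j' k.-1 (run X Y take_left st).
Proof.
move=> [] bst vs vm vh vi vj vsum vw aA aWT aPA it jt kt mB mB0 mL mS.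
move=> im Ai he ce other bst' v10 vold aold; split=> //.
have [s_m m_h h_n] := smh.
have ce' : cnt s m (key e) = cnt s m t by lia.
have [te c1 c2] := merge_pick he ce' other.
have hse : (s <= e < h)%N by lia.
have e_n : (e < n)%N by lia.
have h1 := below_key key_inj (fun=> 1%N) he (leq_trans m_h h_n).
have h2 := below_key key_inj wt he (leq_trans m_h h_n).
have h3 : wsum s m (key e) = wsum s m t by exact: cnt_eq_below.
have j_le := cnt_le key m h t.
have pos : i%:Z + j%:Z - m%:Z = (i + j - m)%N by lia.
(* A threshold just above the key of [e] adds [e] and nothing else: keys are distinct, and by [c1]
   and [c2] the right block contributes no further element. *)
exists (key e).+1, i.+1, j => /=.
rewrite aold v10 !vold // vm vi vj vsum aWT pos (WTP e_n).1.
have hn2 : (n <= n ^ 2)%N by rewrite expnS expn1; nia.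
have := wsum_le s (key e).+1 (leq_trans m_h h_n); rewrite h2 h3 => le_sum.
split=> //=; rewrite ?aold ?vold //.
- apply: bounded_var => //; last by apply: small_cst; lia.
  apply: bounded_var => //; last by apply: small_sq; lia.
  apply: bounded_arr => //; apply: small_cst; lia.
- by lia.
- by rewrite h2 h3 PoszD.
- by lia.
- by lia.
- by lia.
- move=> p hp; case: (p =P (i + j - m)%N) => [->|ne].
    exists e; first by rewrite eqxx.
    by rewrite (below_cat key _ _ s_m m_h); lia.
  rewrite (_ : (p%:Z == (i + j - m)%N) = false); last by lia.
  by apply: mB; lia.
- move=> p hp; rewrite (_ : (p%:Z == (i + j - m)%N) = false); last by lia.
  exact: mB0.
- move=> e' e'n; rewrite mL //; case: (boolP (m <= e' < h)%N) => //= he'.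
  by rewrite (cnt_eq_key c2 he').
- move=> e' e'n; rewrite mS //; case: (boolP (m <= e' < h)%N) => //= he'.
  by rewrite (cnt_eq_key c2 he').
Qed.

Lemma take_rightP t i j k e st0 st :
  merging t i j k st0 -> (j < h)%N -> A0 j%:Z = e%:Z -> (m <= e < h)%N ->
  (m + cnt m h (key e))%N = j ->
  cnt s m t = (m - s)%N \/
    (exists2 e', cnt s m (key e') = cnt s m t & (key e < key e')%N) ->
  bnd st -> vars st 11 = e%:Z -> (forall x, (x < 10)%N -> vars st x = vars st0 x) ->
  arrs st = arrs st0 ->
  safe_cmd X Y take_right st /\
  exists t' i' j', merging t' i' j' k.-1 (run X Y take_right st).
Proof.
move=> [] bst vs vm vh vi vj vsum vw aA aWT aPA it jt kt mB mB0 mL mS.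
move=> jh Aj he ce other bst' v11 vold aold; split=> //.
have [s_m m_h h_n] := smh.
have ce' : cnt m h (key e) = cnt m h t by lia.
have [te c1 c2] := merge_pick he ce' other.
have hse : (s <= e < h)%N by lia.
have e_n : (e < n)%N by lia.
have h1 := below_key key_inj (fun=> 1%N) he h_n.
have h3 : wsum s m (key e) = wsum s m t by exact: cnt_eq_below.
have h4 : wsum s m (key e).+1 = wsum s m t by exact: cnt_eq_below.
have i_le := cnt_le key s m t.
have pos : i%:Z + j%:Z - m%:Z = (i + j - m)%N by lia.
exists (key e).+1, i, j.+1 => /=.
have keyF : (key e < t)%N = false by lia.
have le_sum := wsum_le s t (leq_trans m_h h_n).
have le_L := L0_le e_n.
have le_S := S0_le e_n.
have hn2 : (n <= n ^ 2)%N by rewrite expnS expn1; nia.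
rewrite /= aold v11 !vold // vs vm vi vj vsum pos (mL _ e_n) (mS _ e_n) keyF andbF.
split=> //=; rewrite ?aold ?vold //.
- apply: bounded_var => //; last by apply: small_cst; lia.
  apply: bounded_arr => //; last by apply: small_sq; lia.
  apply: bounded_arr => //; last by apply: small_cst; lia.
  apply: bounded_arr => //; apply: small_cst; lia.
- by lia.
- by rewrite h4.
- by lia.
- by lia.
- by lia.
- move=> p hp; case: (p =P (i + j - m)%N) => [->|ne].
    exists e; first by rewrite eqxx.
    by rewrite (below_cat key _ _ s_m m_h); lia.
  rewrite (_ : (p%:Z == (i + j - m)%N) = false); last by lia.
  by apply: mB; lia.
- move=> p hp; rewrite (_ : (p%:Z == (i + j - m)%N) = false); last by lia.
  exact: mB0.
- move=> e' e'n; case: (e' =P e) => [->|ne].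
    by rewrite eqxx he ltnSn /= c1 it; lia.
  rewrite (_ : (e'%:Z == e%:Z) = false); last by lia.
  rewrite mL //; case: (boolP (m <= e' < h)%N) => //= he'.
  (* No right key lies between [t] and [key e], and [e] alone has its key, so raising the threshold
     does not change whether [e'] is taken. *)
  rewrite -(cnt_eq_key ce' he') [X in _ = Posz (_ + if X then _ else _)]ltnS.
  rewrite [in RHS]leq_eqVlt; case: eqP => // /key_inj h5.
  by case: ne; apply: h5; lia.
- move=> e' e'n; case: (e' =P e) => [->|ne].
    by rewrite eqxx he ltnSn /= h3; lia.
  rewrite (_ : (e'%:Z == e%:Z) = false); last by lia.
  rewrite mS //; case: (boolP (m <= e' < h)%N) => //= he'.
  rewrite -(cnt_eq_key ce' he') [X in _ = Posz (_ + if X then _ else _)]ltnS.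
  rewrite [in RHS]leq_eqVlt; case: eqP => // /key_inj h5.
  by case: ne; apply: h5; lia.
Qed.


Lemma merge_stepP t i j k st : merging t i j k st -> (i + j < m + h)%N ->
  safe_cmd X Y (merge_step b) st /\
  exists t' i' j', merging t' i' j' k.-1 (run X Y (merge_step b) st).
Proof.
move=> mg lt_ij; have [s_m m_h h_n] := smh.
have [bst vs vm vh vi vj vsum vw aA aWT aPA it jt _ _ _ _ _] := mg.
have i_le := cnt_le key s m t.
have j_le := cnt_le key m h t.
pose u := A0 i%:Z; pose v := A0 j%:Z.
have choice (c : int) : (`|c| <= 1)%N ->
    let st' := set_var (set_var (set_var st 10 u) 11 v) 13 c in
    [/\ bnd st', vars st' 10 = u, vars st' 11 = v, vars st' 13 = c &
        (forall x, (x < 10)%N -> vars st' x = vars st x)].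
  move=> hc; split=> //=; last by move=> x hx; do !(case: eqP => [?|_]; first lia).
  apply: bounded_var => //; last by apply: small_cst; lia.
  apply: bounded_var => //; last by rewrite /v -aA; apply: bst.2.
  by apply: bounded_var => //; rewrite /u -aA; apply: bst.2.
have left_elem : (i < m)%N -> exists2 e : nat, u = e%:Z &
    (s <= e < m)%N /\ (s + cnt s m (key e))%N = i.
  by move=> im; apply: sorted_left; lia.
have right_elem : (j < h)%N -> exists2 e : nat, v = e%:Z &
    (m <= e < h)%N /\ (m + cnt m h (key e))%N = j.
  by move=> jh; apply: sorted_right; lia.
have step c : c = 0 \/ c = 1 ->
    let st' := set_var (set_var (set_var st 10 u) 11 v) 13 c in
    safe_cmd X Y (merge_choice b) st -> run X Y (merge_choice b) st = st' ->
    let taken := if c == 0 then take_right else take_left in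
    (safe_cmd X Y taken st' /\
      exists t' i' j', merging t' i' j' k.-1 (run X Y taken st')) ->
    safe_cmd X Y (merge_step b) st /\
      exists t' i' j', merging t' i' j' k.-1 (run X Y (merge_step b) st).
  move=> hc st' hs hr taken hst'.
  have -> : run X Y (merge_step b) st = run X Y taken st'.
    rewrite /merge_step run_seq hr /taken; rewrite /st'; by case: hc => ->.
  split=> //; last by case: hst'.
  rewrite /merge_step safe_seq hs hr /=.
  by case: hst' => + _; rewrite /taken /st'; case: hc => ->.
have run_choice : run X Y (merge_choice b) st = set_var (set_var (set_var st 10 u) 11 v) 13
    (if (i < m)%N then if (j < h)%N then
       ev X Y (set_var (set_var st 10 u) 11 v) (compare b) else 1 else 0).
  rewrite /merge_choice /= aA vi vj vm vh !ltz_nat.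
  by case: (i < m)%N => //=; case: (j < h)%N.
have [im|mi] := ltnP i m; last first.
  have jh : (j < h)%N by lia.
  have [e ve [he ce]] := right_elem jh.
  apply: (step 0); first by left.
  - by rewrite /merge_choice /= aA vi vj vm vh !ltz_nat (ltnNge i) mi.
  - by rewrite run_choice (ltnNge i) mi.
  have [|b' _ v11 _ vold] := choice 0; first by [].
  by apply: (take_rightP mg jh ve he ce) => //; left; lia.
have [e ue [he ce]] := left_elem im.
have [jh|hj] := ltnP j h; last first.
  apply: (step 1); first by right.
  - by rewrite /merge_choice /= aA vi vj vm vh !ltz_nat im (ltnNge j) hj.
  - by rewrite run_choice im (ltnNge j) hj.
  have [|b' v10 _ _ vold] := choice 1; first by [].
  by apply: (take_leftP mg im ue he ce) => //; left; lia.
have [e' ve' [he' ce']] := right_elem jh.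
have e_n : (e < n)%N by lia.
have e'_n : (e' < n)%N by lia.
have := @compareP (set_var (set_var st 10 u) 11 v) e e' e_n e'_n aPA.
rewrite /= => /(_ ue ve')[safe_compare ev_compare].
have safe_choice : safe_cmd X Y (merge_choice b) st.
  by rewrite /merge_choice /= aA vi vj vm vh !ltz_nat im jh /= safe_compare.
have [lt_ee'|le_e'e] := ltnP (key e) (key e').
  rewrite lt_ee' in ev_compare.
  apply: (step 1) => //; first by right.
    by rewrite run_choice im jh ev_compare.
  have [|b' v10 _ _ vold] := choice 1; first by [].
  apply: (take_leftP mg im ue he ce) => //; right; exists e' => //.
  by lia.
rewrite ltnNge le_e'e in ev_compare.
apply: (step 0) => //; first by left.
  by rewrite run_choice im jh ev_compare.
have [|b' _ v11 _ vold] := choice 0; first by [].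
apply: (take_rightP mg jh ve' he' ce') => //; right; exists e; first by lia.
by rewrite ltn_neqAle le_e'e andbT; apply/eqP => /key_inj; lia.
Qed.

Lemma merge_loop t i j st : merging t i j (h - s) st -> i = s -> j = m ->
  terminates X Y w (While merge_guard (merge_step b)) st
    ((worst (merge_step b) + (cost merge_guard).+1) * (h - s) + (cost merge_guard).+1)
    (fun st' => exists t', merging t' m h 0 st').
Proof.
move=> mg ei ej.
pose I k st := exists t i j, merging t i j k st.
apply: (@terminates_while _ _ X Y n_gt1 w I sort_env); last by exists t, i, j.
  exact: small_exp.
move=> k st' [t' [i' [j' mg']]].
have [bst vs vm vh vi vj vsum vw aA aWT aPA it jt kt _ _ _ _] := mg'.
have i_le := cnt_le key s m t'; have j_le := cnt_le key m h t'.
have [s_m m_h h_n] := smh.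
split=> //.
  rewrite /= vi vj vm vh /int_of_bool; case: ifP => // lt_ij _.
  exists t'; have [<- <-] : i' = m /\ j' = h by lia.
  by have <- : k = 0%N by lia.
rewrite /= vi vj vm vh /int_of_bool; case: ifP => // lt_ij _.
exists 1%N; split=> //; first by lia.
have [|sst rst] := merge_stepP mg'; first by lia.
rewrite muln1; apply: (terminates_run n_gt1 (E := sort_env)) => //.
  by apply: small_exp; case: (b).
by rewrite subn1.
Qed.

End Merge.
End Sort.

(** * Merge sort *)

Definition block_bounds : cmd :=
  Assign 4 (Var 3 +' Var 9) ;; If (Size <' Var 4) (Assign 4 Size) Skip ;;
  Assign 5 (Var 4 +' Var 9) ;; If (Size <' Var 5) (Assign 5 Size) Skip ;;
  Assign 6 (Var 3) ;; Assign 7 (Var 4) ;; Assign 8 (Const 0).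

Definition merge_block (b : bool) : cmd :=
  block_bounds ;; While merge_guard (merge_step b) ;; Assign 3 (Var 5).

Definition block_cost (b : bool) : nat :=
  worst block_bounds + (worst (merge_step b) + (cost merge_guard).+1 +
    (cost merge_guard).+1 + worst (Assign 3 (Var 5))).

Definition copy_entry : cmd := Put 0 (Var 2) (Get 1 (Var 2)).

Definition sort_level (b : bool) : cmd :=
  Assign 3 (Const 0) ;; While (Var 3 <' Size) (merge_block b) ;;
  For 2 copy_entry ;; Assign 9 (Var 9 +' Var 9).

Definition for_cost (x : nat) (c : cmd) : nat :=
  worst (c ;; Assign x (Var x +' Const 1)) + 10.

Definition level_cost (b : bool) : nat :=
  worst (Assign 3 (Const 0)) + (block_cost b + (cost (Var 3 <' Size)).+1 +
  (cost (Var 3 <' Size)).+1 + (for_cost 2 copy_entry + worst (Assign 9 (Var 9 +' Var 9)))).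

Definition init_entry : cmd :=
  Put 0 (Var 2) (Var 2) ;; Put 2 (Var 2) (Const 0) ;; Put 3 (Var 2) (Const 0).

Definition merge_sort (b : bool) : cmd :=
  For 2 init_entry ;; Assign 9 (Const 1) ;; While (Var 9 <' Size) (sort_level b).

Definition sort_cost (b : bool) : nat :=
  for_cost 2 init_entry + (worst (Assign 9 (Const 1)) +
  (level_cost b + (cost (Var 9 <' Size)).+1 + (cost (Var 9 <' Size)).+1)).

(** Lower-order terms are padded to multiples of [n], so that each cost is again a single constant
    times the size. *)
Lemma level_cost_le (a B g F c n : nat) : (0 < n)%N ->
  (a + ((B + g) * n + g + (F * n + c)) <= (a + (B + g + g + (F + c))) * n)%N.
Proof.
move=> n0; have pad k : (k <= k * n)%N by rewrite leq_pmulr.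
have := pad a; have := pad g; have := pad c; rewrite !mulnDl; lia.
Qed.

Lemma sort_cost_le (F a B g n l : nat) : (0 < n)%N -> (0 < l)%N ->
  (F * n + (a + ((B + g) * (n * l) + g)) <= (F + (a + (B + g + g))) * (n * l))%N.
Proof.
move=> n0 l0; have pad k : (k <= k * (n * l))%N by rewrite leq_pmulr // muln_gt0 n0.
have : (F * n <= F * (n * l))%N by rewrite leq_mul // leq_pmulr.
by have := pad a; have := pad g; rewrite !mulnDl; lia.
Qed.

Section Sort.
Variables (R : realType) (n : nat) (X Y : 'I_n -> R).
Hypothesis n_gt1 : (1 < n)%N.
Variable w : nat.
Hypothesis small_exp : forall d, (d <= 200)%N -> (n ^ d < 2 ^ w)%N.

Local Notation bnd := (bounded n sort_env).

Lemma terminates_for_cost (I : nat -> state -> Prop) x c s :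
  let body := c ;; Assign x (Var x +' Const 1) in
  (deg sort_env (Var x <' Size) <= 200)%N ->
  (deg_cmd sort_env body <= 200)%N -> loop_free c ->
  bnd s -> I 0%N (set_var s x 0) ->
  (forall i s', I i s' -> bnd s' /\ vars s' x = i%:Z) ->
  (forall i s', (i < n)%N -> I i s' ->
     safe_cmd X Y body s' /\ I i.+1 (run X Y body s')) ->
  terminates X Y w (For x c) s (for_cost x c * n) (I n).
Proof.
move=> body h1 h2 lc bs I0 hI step.
apply: (terminates_weaken (Q := I n) (terminates_for n_gt1 (E := sort_env) _ _ lc bs I0 hI step)) => //.
- exact: small_exp.
- exact: small_exp.
rewrite /for_cost -/body; nia.
Qed.

Variables (b : bool) (key wt : nat -> nat) (WT PA : int -> int).
Hypothesis key_inj : forall e e', (e < n)%N -> (e' < n)%N -> key e = key e' -> e = e'.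
Hypothesis compareP : forall s e e', (e < n)%N -> (e' < n)%N ->
  arrs s 5 = PA -> vars s 10 = e%:Z -> vars s 11 = e'%:Z ->
  safe X Y s (compare b) /\ ev X Y s (compare b) = int_of_bool (key e < key e')%N.
Hypothesis WTP : forall e, (e < n)%N -> WT e%:Z = wt e /\ (wt e <= n)%N.

Local Notation cnt := (below key (fun _ => 1%N)).
Local Notation wsum := (below key wt).

Definition base (d e : nat) : nat := (e %/ d * d)%N.

Lemma base_block (d k e : nat) : (k * d <= e < k * d + d)%N -> base d e = (k * d)%N.
Proof.
move=> he; congr (_ * _)%N.
have d0 : (0 < d)%N by lia.
have -> : e = (k * d + (e - k * d))%N by lia.
by rewrite divnMDl // divn_small ?addn0 //; lia.
Qed.

Lemma base_large d e : (e < d)%N -> base d e = 0%N.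
Proof. by move=> h; rewrite /base divn_small. Qed.

Definition sorted_at (d : nat) (A : int -> int) (p : nat) : Prop :=
  let lo := base d p in let hi := minn n (lo + d) in
  exists2 e : nat, A p%:Z = e%:Z & (lo <= e < hi)%N /\ (lo + cnt lo hi (key e))%N = p.

(** Invariant within a level: the blocks starting before [v] are already merged. There arrays 2 and
    3 refer to predecessors in the block of width [2 * d], elsewhere to those in the block of width
    [d]. *)
Record leveling (d : nat) (A0 : int -> int) (v : nat) (st : state) : Prop := Leveling {
  lv_bnd : bnd st; lv_v : vars st 3 = v%:Z; lv_d : vars st 9 = d%:Z;
  lv_A : arrs st 0 = A0; lv_WT : arrs st 4 = WT; lv_PA : arrs st 5 = PA;
  lv_n : (v <= n)%N; lv_dvd : v = n \/ exists k, v = (k * (2 * d))%N;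
  lv_B : forall p, (p < v)%N -> sorted_at (2 * d) (arrs st 1) p;
  lv_L : forall e, (e < n)%N -> arrs st 2 e%:Z =
    cnt (base (if (e < v)%N then 2 * d else d)%N e) e (key e);
  lv_S : forall e, (e < n)%N -> arrs st 3 e%:Z =
    wsum (base (if (e < v)%N then 2 * d else d)%N e) e (key e) }.

Lemma merge_blockP d A0 v st : (0 < d)%N -> (d < n)%N ->
  (forall p, (p < n)%N -> sorted_at d A0 p) ->
  leveling d A0 v st -> (v < n)%N ->
  let h := minn n (v + 2 * d) in
  terminates X Y w (merge_block b) st (block_cost b * (h - v)) (leveling d A0 h).
Proof.
move=> d0 dn sA [] bst vv vd aA aWT aPA lvn dvd lB lL lS v_n h.
have [k vk] : exists k, v = (k * (2 * d))%N by case: dvd => // ?; lia.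
pose m := minn n (v + d).
have hm : minn n (m + d) = h by rewrite /m /h; lia.
have [v_m m_h h_n] : [/\ v <= m, m <= h & h <= n]%N by split; rewrite ?/m ?/h; lia.
pose st1 := run X Y block_bounds st.
(* The cases are which ends are cut off at [n]; if the left block is cut, the right one is empty. *)
have est1 : exists st0, [/\ st1 = set_var (set_var (set_var st0 6 v) 7 m) 8 0, bnd st0,
    vars st0 3 = v%:Z, vars st0 4 = m%:Z & vars st0 5 = h%:Z /\
    vars st0 9 = d%:Z /\ arrs st0 = arrs st].
  rewrite /st1 /block_bounds /= vv vd -PoszD ltz_nat.
  have [nm|mn] := ltnP n (v + d) => /=; rewrite ?vv ?vd -?PoszD ltz_nat.
  - have [nh|hn] := ltnP n (n + d) => /=; last by lia.
    have -> : n%:Z = m by rewrite /m; lia.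
    eexists; split; first (by rewrite vv); last (by split=> //=; rewrite /h /m; lia).
    + apply: bounded_var => //; last by apply: small_cst => //; lia.
      apply: bounded_var => //; last by apply: small_cst => //; lia.
      apply: bounded_var => //; last by apply: small_cst => //; lia.
      by apply: bounded_var => //; apply: small_cst => //; lia.
    + by [].
    + by [].
  - have [nh|hn] := ltnP n (v + d + d) => /=.
      have -> : (v + d)%N%:Z = m by rewrite /m; lia.
      eexists; split; first (by rewrite vv); last (by split=> //=; rewrite /h /m; lia).
      - apply: bounded_var => //; last by apply: small_cst => //; lia.
        apply: bounded_var => //; last by apply: small_cst => //; lia.
        by apply: bounded_var => //; apply: small_cst => //; lia.
      - by [].
      - by [].
    have -> : (v + d)%N%:Z = m by rewrite /m; lia.
    eexists; split; first (by rewrite vv); last (by split=> //=; rewrite /h /m; lia).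
    - apply: bounded_var => //; last by apply: small_cst => //; lia.
      by apply: bounded_var => //; apply: small_cst => //; lia.
    - by [].
    - by [].
have [st0 [e1 b0 v3 v4 [v5 [v9 a0]]]] := est1.
have bst1 : bnd st1.
  rewrite e1; apply: bounded_var => //.
  apply: bounded_var => //; last by apply: small_cst => //; lia.
  by apply: bounded_var => //; apply: small_cst => //; lia.
pose L0 e := cnt (base (if (e < v)%N then 2 * d else d)%N e) e (key e).
pose S0 e := wsum (base (if (e < v)%N then 2 * d else d)%N e) e (key e).
have base_l p : (v <= p < m)%N -> base d p = v.
  by move=> hp; rewrite (@base_block d (k * 2)); rewrite /m; lia.
have base_r p : (m <= p < h)%N -> base d p = m.
  by move=> hp; rewrite (@base_block d (k * 2).+1); move: hp; rewrite /m /h; lia.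
have base_2 p : (v <= p < h)%N -> base (2 * d) p = v.
  by move=> hp; rewrite (@base_block (2 * d) k); move: hp; rewrite /h; lia.
have sl : sorted_block key A0 v m.
  move=> p hp; have := sA p; rewrite /sorted_at (base_l _ hp) -/m; apply; lia.
have sr : sorted_block key A0 m h.
  move=> p hp; have := sA p; rewrite /sorted_at (base_r _ hp) hm; apply; lia.
have cnt0 lo hi : below key (fun=> 1%N) lo hi 0 = 0%N by rewrite /below big_pred0.
have wsum0 lo hi : wsum lo hi 0 = 0%N by rewrite /below big_pred0.
have mg : merging n key wt WT PA v m h d%:Z A0 (arrs st 1) L0 S0 0 v m (h - v) st1.
  rewrite e1; split; rewrite /= ?a0 ?cnt0 ?wsum0 ?addn0 //; rewrite -?e1 //.
  - by lia.
  - by move=> p; lia.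
  - by move=> e he; rewrite lL // ltn0 andbF addn0.
  - by move=> e he; rewrite lS // ltn0 andbF addn0.
pose C1 := (worst (merge_step b) + (cost merge_guard).+1)%N.
have hv0 : (0 < h - v)%N by rewrite /h; lia.
apply: (terminates_weaken (Q := leveling d A0 h)
  (T := worst block_bounds + ((C1 * (h - v) + (cost merge_guard).+1) + worst (Assign 3 (Var 5))))) => //.
- apply: (@terminates_seq _ _ _ _ _ _ _ _ _ _ (fun s => s = st1)).
    apply: (terminates_run n_gt1 (E := sort_env)) => //; first exact: small_exp.
    by rewrite /= vv vd -PoszD ltz_nat; do !case: ifP.
  move=> _ ->.
  apply: (@terminates_seq _ _ _ _ _ _ _ _ _ _
     (fun s => exists t, merging n key wt WT PA v m h d%:Z A0 (arrs st 1) L0 S0 t m h 0 s)).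
    apply: (merge_loop n_gt1 small_exp key_inj compareP WTP _ _ _ _ _ mg) => //.
    + move=> e en; apply: leq_trans (cnt_le _ _ _ _) _; lia.
    + move=> e en; apply: (wsum_le n_gt1 key WTP); lia.
  move=> s2 [t [] b2 m_s m_m m_h' m_i m_j _ m_w m_A m_WT m_PA m_it m_jt _ m_B m_B0 m_L m_S].
  apply: (terminates_run n_gt1 (E := sort_env)) => //; first exact: small_exp.
  (* All right elements have been taken, so the final threshold exceeds their keys. *)
  have mlt e : (m <= e < h)%N -> (key e < t)%N.
    by apply: cnt_full; lia.
  split; rewrite /= ?m_h' //.
  + by apply: bounded_var => //; apply: small_cst => //; lia.
  + have [hn|hn] := leqP n (v + 2 * d); first by left; rewrite /h; lia.
    by right; exists k.+1; rewrite /h; lia.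
  + move=> p ph; have [pv|vp] := ltnP p v.
      by have := lB p pv; rewrite /sorted_at m_B0 //; lia.
    rewrite /sorted_at base_2; last by lia.
    by apply: m_B; lia.
  + move=> e en; rewrite m_L // /L0.
    have [ev|ve] := ltnP e v.
      have [-> ->] : (m <= e < h)%N = false /\ (e < h)%N by split; lia.
      by rewrite addn0.
    have [he|he] := leqP h e; first by rewrite andbF addn0.
    rewrite base_2; last by lia.
    have [me|em] := leqP m e.
      rewrite mlt /=; last by lia.
      rewrite base_r; last by lia.
      (* The whole left half precedes an element of the right half, so the count made during the
         merge is added to the old one. *)
      by rewrite (below_cat key _ _ v_m me) addnC.
    by rewrite addn0 base_l //; lia.
  + move=> e en; rewrite m_S // /S0.
    have [ev|ve] := ltnP e v.
      have [-> ->] : (m <= e < h)%N = false /\ (e < h)%N by split; lia.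
      by rewrite addn0.
    have [he|he] := leqP h e; first by rewrite andbF addn0.
    rewrite base_2; last by lia.
    have [me|em] := leqP m e.
      rewrite mlt /=; last by lia.
      rewrite base_r; last by lia.
      by rewrite (below_cat key _ _ v_m me) addnC.
    by rewrite addn0 base_l //; lia.
- rewrite /block_cost -/C1; nia.
Qed.

Record sorted_upto (d : nat) (st : state) : Prop := SortedUpto {
  su_bnd : bnd st; su_d : vars st 9 = d%:Z; su_gt0 : (0 < d)%N;
  su_WT : arrs st 4 = WT; su_PA : arrs st 5 = PA;
  su_A : forall p, (p < n)%N -> sorted_at d (arrs st 0) p;
  su_L : forall e, (e < n)%N -> arrs st 2 e%:Z = cnt (base d e) e (key e);
  su_S : forall e, (e < n)%N -> arrs st 3 e%:Z = wsum (base d e) e (key e) }.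

Lemma sort_levelP d st : sorted_upto d st -> (d < n)%N ->
  terminates X Y w (sort_level b) st (level_cost b * n) (sorted_upto (2 * d)).
Proof.
move=> [] bst vd d0 aWT aPA sA sL sS dn.
pose A0 := arrs st 0.
have n_n2 : (n <= n ^ 2)%N by rewrite expnS expn1; nia.
pose copying k s1 := [/\ bnd s1, vars s1 2 = k%:Z, vars s1 9 = d%:Z /\ arrs s1 4 = WT,
  arrs s1 5 = PA & [/\ forall p, (p < n)%N -> sorted_at (2 * d) (arrs s1 1) p,
    forall p : nat, (p < k)%N -> arrs s1 0 p%:Z = arrs s1 1 p%:Z,
    forall e, (e < n)%N -> arrs s1 2 e%:Z = cnt (base (2 * d) e) e (key e) &
    forall e, (e < n)%N -> arrs s1 3 e%:Z = wsum (base (2 * d) e) e (key e)]].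
apply: (terminates_weaken (Q := sorted_upto (2 * d))
  (T := worst (Assign 3 (Const 0)) + (((block_cost b + (cost (Var 3 <' Size)).+1) * n + (cost (Var 3 <' Size)).+1) +
    (for_cost 2 copy_entry * n + worst (Assign 9 (Var 9 +' Var 9)))))) => //.
  apply: (@terminates_seq _ _ _ _ _ _ _ _ _ _ (leveling d A0 0)).
    apply: (terminates_run n_gt1 (E := sort_env)) => //; first exact: small_exp.
    split=> //=.
    - exact: bounded_var.
    - by right; exists 0%N.
  move=> s1 lv1.
  apply: (@terminates_seq _ _ _ _ _ _ _ _ _ _ (leveling d A0 n)).
    (* The potential is the number of positions not yet merged. Each block pays exactly its length,
       whence a linear bound for the level. *)
    pose I k s' := (k <= n)%N /\ leveling d A0 (n - k)%N s'.
    apply: (terminates_while (I := I) n_gt1 (E := sort_env)) => //.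
    - exact: small_exp.
    - move=> k s' [kn lv']; have [bs' vv _ _ _ _ _ _ _ _ _] := lv'.
      split=> //=; rewrite vv ltz_nat /int_of_bool; case: ifP => // h _.
        by have <- : (n - k = n)%N by lia.
      exists (minn n (n - k + 2 * d) - (n - k))%N; split; first by lia.
        by lia.
      apply: (terminates_weaken (merge_blockP d0 dn sA lv' h)) => // s2 lv2.
      split; first by lia.
      have -> // : (n - (k - (minn n (n - k + 2 * d) - (n - k))) = minn n (n - k + 2 * d))%N by lia.
    - by split; rewrite ?subnn.
  move=> s2 [b2 v2 d2 A2 WT2 PA2 _ _ B2 L2 S2].
  apply: (@terminates_seq _ _ _ _ _ _ _ _ _ _ (copying n)).
    apply: (terminates_for_cost (I := copying)) => //.
    - split=> //=; first exact: bounded_var.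
      split=> // e en; first by rewrite L2 ?en.
      by rewrite S2 ?en.
    - by move=> i s' [].
    - move=> i s' i_n [bs' v2' [v9 a4] a5 [hB hA hL hS]]; split=> //=.
      rewrite !v2'; split=> /=; rewrite ?v2' //.
      + apply: bounded_var => //; last by apply: small_cst => //; lia.
        by apply: bounded_arr => //; apply: bs'.2.
      + by lia.
      + split=> // p pi; case: eqP => [->//|ne].
        by apply: hA; lia.
  move=> s3 [b3 v23 [v93 a43] a53 [hB hA hL hS]].
  apply: (terminates_run n_gt1 (E := sort_env)) => //; first exact: small_exp.
  split=> //=.
  - by apply: bounded_var => //; apply: small_cst => //; lia.
  - by rewrite v93; lia.
  - by lia.
  - move=> p pn; have := hB p pn; rewrite /sorted_at.
    by rewrite hA.
by apply: level_cost_le; exact: ltnW.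
Qed.

Lemma merge_sortP st : bnd st -> arrs st 4 = WT -> arrs st 5 = PA ->
  terminates X Y w (merge_sort b) st (sort_cost b * (n * (trunc_log 2 n).+1))
    (fun s => [/\ bnd s, arrs s 4 = WT, arrs s 5 = PA,
       forall p, (p < n)%N -> exists2 e : nat, arrs s 0 p%:Z = e%:Z &
         (e < n)%N /\ cnt 0 n (key e) = p &
       (forall e, (e < n)%N -> arrs s 2 e%:Z = cnt 0 e (key e)) /\
       (forall e, (e < n)%N -> arrs s 3 e%:Z = wsum 0 e (key e))]).
Proof.
move=> bst a4 a5.
set Q := (Q in terminates _ _ _ _ _ _ Q).
pose l := (trunc_log 2 n).+1.
pose init k s1 := [/\ bnd s1, vars s1 2 = k%:Z, arrs s1 4 = WT, arrs s1 5 = PA &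
  [/\ forall p : nat, (p < k)%N -> arrs s1 0 p%:Z = p%:Z,
    forall e : nat, (e < k)%N -> arrs s1 2 e%:Z = 0 &
    forall e : nat, (e < k)%N -> arrs s1 3 e%:Z = 0]].
apply: (terminates_weaken (Q := Q)
  (T := for_cost 2 init_entry * n + (worst (Assign 9 (Const 1)) +
    ((level_cost b + (cost (Var 9 <' Size)).+1) * (n * l) + (cost (Var 9 <' Size)).+1)))) => //.
  apply: (@terminates_seq _ _ _ _ _ _ _ _ _ _ (init n)).
    apply: (terminates_for_cost (I := init)) => //.
    - by split=> //=; exact: bounded_var.
    - by move=> i s' [].
    - move=> i s' i_n [bs' v2 a4' a5' [hA hL hS]]; split=> //=.
      rewrite !v2; split=> /=; rewrite ?v2 //.
      + apply: bounded_var => //; last by apply: small_cst => //; lia.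
        apply: bounded_arr => //; apply: bounded_arr => //.
        by apply: bounded_arr => //; apply: small_cst => //; lia.
      + by lia.
      + split=> p pi; case: eqP => [|ne] //; first [by apply: hA; lia|by apply: hL; lia|by apply: hS; lia].
  move=> s1 [b1 v2 a41 a51 [hA hL hS]].
  apply: (@terminates_seq _ _ _ _ _ _ _ _ _ _ (sorted_upto 1)).
    apply: (terminates_run n_gt1 (E := sort_env)) => //; first exact: small_exp.
    have base1 e : base 1 e = e by rewrite /base divn1 muln1.
    split=> //=.
    - by apply: bounded_var => //; apply: small_cst => //; lia.
    - move=> p pn; exists p; first exact: hA.
      rewrite base1; split; first by lia.
      rewrite (_ : minn n (p + 1) = p.+1); last by lia.
      by rewrite /below big_mkcond big_nat1 ltnn addn0.
    - by move=> e en; rewrite hL // base1 /below big_geq.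
    - by move=> e en; rewrite hS // base1 /below big_geq.
  move=> s2 su2.
  (* Each level uses up [n]. At most [l] levels occur, since a further one needs [2 ^ j < n] and
     [n < 2 ^ l]. *)
  pose I k s' := exists2 j, (j <= l)%N & k = (n * (l - j))%N /\ sorted_upto (2 ^ j) s'.
  apply: (terminates_while (I := I) n_gt1 (E := sort_env)) => //.
  - exact: small_exp.
  - move=> k s' [j jl [kE su]]; have [bs' vd d0 a4' a5' hA' hL' hS'] := su.
    split=> //; rewrite /= vd ltz_nat /int_of_bool; case: ifP => // h _.
      split=> //.
      + move=> p pn; have := hA' _ pn; rewrite /sorted_at base_large; last by lia.
        rewrite add0n (_ : minn n (2 ^ j) = n); last by lia.
        by move=> [e he [/andP[_ h1] h2]]; exists e.
      + by split=> e en; rewrite ?hL' ?hS' // base_large //; lia.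
    have jl' : (j < l)%N.
      rewrite -(ltn_exp2l _ _ (ltnSn 1)); apply: leq_trans h _.
      by rewrite ltnW // /l trunc_log_ltn.
    exists n; split; first by lia.
      by rewrite kE leq_pmulr // subn_gt0.
    apply: (terminates_weaken (sort_levelP su h)) => // s'' su''.
    exists j.+1 => //; split; last by rewrite expnS.
    by rewrite kE (_ : (l - j = (l - j.+1).+1)%N) ?mulnS ?addKn //; lia.
  - by exists 0%N => //; rewrite subn0.
by apply: sort_cost_le => //; exact: ltnW.
Qed.

End Sort.

(** * Computing the ranks and the summands *)

Definition store_order : cmd := Put 5 (Var 2) (Get 0 (Var 2)).
Definition store_rank : cmd := Put 4 (Get 0 (Var 2)) (Var 2).
(** The term is evaluated before the rank of the current point enters variable 14, which therefore
    holds the sum over strictly smaller positions. *)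
Definition add_term (term : expr) : cmd :=
  Assign 12 (Var 12 +' term) ;; Assign 14 (Var 14 +' Get 4 (Var 2)).
Definition clear_sums : cmd := Assign 12 (Const 0) ;; Assign 14 (Const 0).
Definition output (num den : expr) : cmd := Assign 0 num ;; Assign 1 den.

(* The first pass sorts the points by abscissa. The other two start from that
   order and sort by ordinate: the second one yields the ranks of the ordinates,
   which are the weights that the third one sums. *)
Definition rank_passes : cmd :=
  merge_sort true ;; For 2 store_order ;;
  merge_sort false ;; For 2 store_rank ;; merge_sort false.

Definition program (term num den : expr) : cmd :=
  rank_passes ;; clear_sums ;; For 2 (add_term term) ;; output num den.

Definition program_cost (term num den : expr) : nat :=
  (sort_cost true + (for_cost 2 store_order + (sort_cost false +
    (for_cost 2 store_rank + sort_cost false)))) +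
  (worst clear_sums + (for_cost 2 (add_term term) + worst (output num den))).

Section Ranks.
Variables (n : nat).

Definition on_nat (f : 'I_n -> nat) (e : nat) : nat := oapp f 0%N (insub e).

Lemma on_natE (f : 'I_n -> nat) (i : 'I_n) : on_nat f i = f i.
Proof. by rewrite /on_nat valK. Qed.

Lemma sum_ord_lt (v : nat) : (v <= n)%N -> (\sum_(i < n) (i < v) = v)%N.
Proof.
move=> vn; rewrite -big_mkcond -(big_ord_widen n (fun=> 1%N) vn).
by rewrite sum1_card card_ord.
Qed.

Lemma sum_perm_lt (p : 'S_n) (v : nat) : (v <= n)%N -> (\sum_(i < n) (p i < v) = v)%N.
Proof.
move=> vn; rewrite -[RHS](sum_ord_lt vn) [RHS](reindex_inj (h := p)) //.
exact: perm_inj.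
Qed.

Lemma below_ord (f g : 'I_n -> nat) m t : (m <= n)%N ->
  below (on_nat f) (on_nat g) 0 m t = (\sum_(j < n | (f j < t) && (j < m)) g j)%N.
Proof.
move=> mn; rewrite /below big_mkord.
rewrite (big_ord_widen_cond n (fun e => on_nat f e < t)%N (on_nat g)) //.
by apply: eq_big => j; rewrite !on_natE.
Qed.

Lemma cnt_ord (f : 'I_n -> nat) m t : (m <= n)%N ->
  below (on_nat f) (fun=> 1%N) 0 m t = (\sum_(j < n | (f j < t) && (j < m)) 1)%N.
Proof.
move=> mn; rewrite /below big_mkord.
rewrite (big_ord_widen_cond n (fun e => on_nat f e < t)%N (fun=> 1%N)) //.
by apply: eq_bigl => j; rewrite !on_natE.
Qed.

Lemma cnt_perm (p : 'S_n) (v : nat) : (v <= n)%N ->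
  below (on_nat (fun i => p i)) (fun=> 1%N) 0 n v = v.
Proof.
move=> vn; rewrite cnt_ord // -[RHS](sum_perm_lt p vn) big_mkcond.
by apply: eq_bigr => j _; rewrite ltn_ord andbT.
Qed.

Lemma on_nat_inj (f : 'I_n -> nat) e e' : injective f ->
  (e < n)%N -> (e' < n)%N -> on_nat f e = on_nat f e' -> e = e'.
Proof.
move=> injf en e'n.
rewrite -[e]/(nat_of_ord (Ordinal en)) -[e']/(nat_of_ord (Ordinal e'n)) !on_natE.
by move=> /injf ->.
Qed.

End Ranks.

Lemma rank_lt (R : realType) n (Z : 'I_n -> R) i j :
  injective Z -> (rank Z i < rank Z j)%N = (Z i < Z j).
Proof.
move=> injZ.
have mono k l : Z k < Z l -> (rank Z k < rank Z l)%N.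
  move=> lt_kl; apply/proper_card/properP; split.
    by apply/subsetP => m; rewrite !inE => /lt_trans; apply.
  by exists k; rewrite inE ?ltxx.
case: (ltgtP (Z i) (Z j)) => [/mono -> //|/mono h|/injZ ->]; last by rewrite ltnn.
by rewrite ltnNge ltnW.
Qed.

Lemma passes_cost_le (a b c d e n m : nat) : (n <= m)%N ->
  (a * m + (b * n + (c * m + (d * n + e * m))) <= (a + (b + (c + (d + e)))) * m)%N.
Proof. by move=> nm; rewrite !mulnDl !leq_add ?leq_mul. Qed.

Lemma program_cost_le (A c F g n l : nat) : (0 < n)%N -> (0 < l)%N ->
  (A * (n * l) + (c + (F * n + g)) <= (A + (c + (F + g))) * (n * l))%N.
Proof.
move=> n0 l0; have pad k : (k <= k * (n * l))%N by rewrite leq_pmulr // muln_gt0 n0.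
have : (F * n <= F * (n * l))%N by rewrite leq_mul // leq_pmulr.
by have := pad c; have := pad g; rewrite !mulnDl; lia.
Qed.

Lemma abszD_le (a b : int) : (`|(a + b)%R| <= `|a| + `|b|)%N.
Proof. lia. Qed.

Section Program.
Variables (R : realType) (n : nat) (X Y : 'I_n -> R).
Hypothesis n_gt1 : (1 < n)%N.
Hypothesis injX : injective X.
Hypothesis injY : injective Y.
Variable w : nat.
Hypothesis small_exp : forall d, (d <= 200)%N -> (n ^ d < 2 ^ w)%N.

Local Notation bnd := (bounded n sort_env).
Local Notation pi := (induced_perm X Y).

Definition rank_perm : 'S_n := perm (rank_inj injX).
Definition point_of (p : 'I_n) : 'I_n := (rank_perm^-1)%g p.

Lemma rank_point_of p : rank X (point_of p) = p.
Proof. by rewrite -(permE (rank_inj injX)) permKV. Qed.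

Lemma point_of_rank i : point_of (rank X i) = i.
Proof. by rewrite -(permE (rank_inj injX)) /point_of permK. Qed.

Lemma point_of_inj : injective point_of.
Proof. exact: perm_inj. Qed.

Lemma ltX_point_of i j : (X (point_of i) < X (point_of j)) = (i < j)%N.
Proof. by rewrite -rank_lt // !rank_point_of. Qed.

Lemma ltY_point_of i j : (Y (point_of i) < Y (point_of j)) = (pi i < pi j)%N.
Proof.
by rewrite -rank_lt // -!(induced_permP injX injY) !rank_point_of.
Qed.

Local Notation keyX := (on_nat (fun i : 'I_n => nat_of_ord (rank X i))).
Local Notation keyP := (on_nat (fun i : 'I_n => nat_of_ord (pi i))).

Lemma compareX PA s e e' : (e < n)%N -> (e' < n)%N ->
  arrs s 5 = PA -> vars s 10 = e%:Z -> vars s 11 = e'%:Z ->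
  safe X Y s (compare true) /\
    ev X Y s (compare true) = int_of_bool (keyX e < keyX e')%N.
Proof.
move=> en e'n _ v10 v11.
rewrite /= v10 v11 /compare_total /compare_coord /index_of.
rewrite -[e]/(nat_of_ord (Ordinal en)) -[e']/(nat_of_ord (Ordinal e'n)) !on_natE !valK.
by rewrite /= rank_lt.
Qed.

(** From the second pass on, elements are positions by abscissa; array 5 translates them back to
    input indices before their ordinates are compared. *)
Lemma compareY PA : (forall p : 'I_n, PA p%:Z = (point_of p)%:Z) ->
  forall s e e', (e < n)%N -> (e' < n)%N ->
  arrs s 5 = PA -> vars s 10 = e%:Z -> vars s 11 = e'%:Z ->
  safe X Y s (compare false) /\
    ev X Y s (compare false) = int_of_bool (keyP e < keyP e')%N.
Proof.
move=> hPA s e e' en e'n a5 v10 v11.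
rewrite /= v10 v11 a5 /compare_total /compare_coord /index_of.
rewrite -[e]/(nat_of_ord (Ordinal en)) -[e']/(nat_of_ord (Ordinal e'n)) !on_natE !hPA !valK.
by rewrite /= ltY_point_of.
Qed.

Definition lower_left (i : 'I_n) : nat := \sum_(j < n | (pi j < pi i)%N && (j < i)%N) 1.
Definition lower_left_sum (i : 'I_n) : nat :=
  \sum_(j < n | (pi j < pi i)%N && (j < i)%N) pi j.

Record ranked (s : state) : Prop := Ranked {
  rk_bnd : bnd s;
  rk_y : forall i : 'I_n, arrs s 4 i%:Z = (pi i)%:Z;
  rk_L : forall i : 'I_n, arrs s 2 i%:Z = (lower_left i)%:Z;
  rk_S : forall i : 'I_n, arrs s 3 i%:Z = (lower_left_sum i)%:Z }.

Lemma rank_passesP :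
  terminates X Y w rank_passes init_state
    ((sort_cost true + (for_cost 2 store_order + (sort_cost false +
      (for_cost 2 store_rank + sort_cost false)))) * (n * (trunc_log 2 n).+1))
    ranked.
Proof.
set l := (trunc_log 2 n).+1.
apply: (terminates_weaken (Q := ranked) (T := sort_cost true * (n * l) +
    (for_cost 2 store_order * n + (sort_cost false * (n * l) +
    (for_cost 2 store_rank * n + sort_cost false * (n * l)))))) => //; last first.
  by apply: passes_cost_le; rewrite leq_pmulr.
(* Array 4 is still zero during the first two passes, of which only the resulting order is used. *)
pose WT0 : int -> int := fun=> 0.
pose Q1 s := [/\ bnd s, arrs s 4 = WT0 &
  forall p : 'I_n, arrs s 0 p%:Z = (point_of p)%:Z].
apply: (@terminates_seq _ _ _ _ _ _ _ _ _ _ Q1).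
  have keyX_inj e e' : (e < n)%N -> (e' < n)%N -> keyX e = keyX e' -> e = e'.
    by apply: on_nat_inj => i j /val_inj /(rank_inj injX).
  have WT0P e : (e < n)%N -> WT0 e%:Z = (fun=> 0%N) e /\ (0 <= n)%N by [].
  have b0 : bnd init_state by split.
  apply: (terminates_weaken
    (merge_sortP n_gt1 small_exp keyX_inj (@compareX (fun=> 0)) WT0P b0 erefl erefl)) => //.
  move=> s [bs a4 _ hA _]; split=> // p.
  have [e -> [en]] := hA p (ltn_ord p).
  rewrite -[e]/(nat_of_ord (Ordinal en)) on_natE.
  have -> : below keyX (fun=> 1%N) 0 n (rank X (Ordinal en)) = rank X (Ordinal en).
    rewrite cnt_ord; last exact: leqnn.
    rewrite -[RHS](sum_perm_lt rank_perm (ltnW (ltn_ord _))) big_mkcond.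
    by apply: eq_bigr => j _; rewrite ltn_ord andbT permE.
  by move=> /val_inj <-; rewrite point_of_rank.
move=> s1 [b1 a41 A1].
pose Q2 k s := [/\ bnd s, vars s 2 = k%:Z, arrs s 4 = WT0,
   forall p : 'I_n, arrs s 0 p%:Z = (point_of p)%:Z &
   forall p : 'I_n, (p < k)%N -> arrs s 5 p%:Z = (point_of p)%:Z].
apply: (@terminates_seq _ _ _ _ _ _ _ _ _ _ (Q2 n)).
  apply: (terminates_for_cost n_gt1 small_exp (I := Q2)) => //.
  - by split=> //=; exact: bounded_var.
  - by move=> i s' [].
  - move=> i s' i_n [bs' v2 a4 A5 A5']; split=> //=; split; rewrite /= ?v2 //.
    + apply: bounded_var => //; last by apply: small_cst => //; lia.
      by apply: bounded_arr => //; apply: bs'.2.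
    + by lia.
    + by move=> p pi'; case: eqP => [<-|ne]; rewrite ?A5 // A5' //; lia.
move=> s2 [b2 _ a42 _ A52].
have A52' (p : 'I_n) : arrs s2 5 p%:Z = (point_of p)%:Z by apply: A52; exact: ltn_ord.
pose Q3 s := [/\ bnd s, arrs s 5 = arrs s2 5 &
  forall p : 'I_n, arrs s 0 p%:Z = ((pi^-1)%g p)%:Z].
have keyP_inj e e' : (e < n)%N -> (e' < n)%N -> keyP e = keyP e' -> e = e'.
  by apply: on_nat_inj => i j /val_inj /perm_inj.
apply: (@terminates_seq _ _ _ _ _ _ _ _ _ _ Q3).
  have WT0P e : (e < n)%N -> WT0 e%:Z = (fun=> 0%N) e /\ (0 <= n)%N by [].
  apply: (terminates_weaken
    (merge_sortP n_gt1 small_exp keyP_inj (compareY A52') WT0P b2 a42 erefl)) => //.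
  move=> s [bs a4 a5 hA _]; split=> // p.
  have [e -> [en]] := hA p (ltn_ord p).
  rewrite -[e]/(nat_of_ord (Ordinal en)) on_natE cnt_perm; last exact: ltnW (ltn_ord _).
  by move=> /val_inj <-; rewrite permK.
move=> s3 [b3 a53 A3].
(* The second sort leaves the inverse permutation in array 0. The loop runs over values and inverts
   it, so after [k] rounds the ranks below [k] are in place. *)
pose Q4 k s := [/\ bnd s, vars s 2 = k%:Z, arrs s 5 = arrs s2 5,
   forall p : 'I_n, arrs s 0 p%:Z = ((pi^-1)%g p)%:Z &
   forall i : 'I_n, (pi i < k)%N -> arrs s 4 i%:Z = (pi i)%:Z].
apply: (@terminates_seq _ _ _ _ _ _ _ _ _ _ (Q4 n)).
  apply: (terminates_for_cost n_gt1 small_exp (I := Q4)) => //.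
  - by split=> //=; exact: bounded_var.
  - by move=> i s' [].
  - move=> i s' i_n [bs' v2 a5 A0 A4]; split=> //=; split; rewrite /= ?v2 //.
    + apply: bounded_var => //; last by apply: small_cst => //; lia.
      by apply: bounded_arr => //; apply: small_cst => //; lia.
    + by lia.
    + move=> q qi; rewrite -[i]/(nat_of_ord (Ordinal i_n)) A0; case: eqP => [[/val_inj ->]|ne].
        by rewrite permKV.
      apply: A4; move: qi; rewrite ltnS leq_eqVlt => /orP[/eqP qi|//].
      by case: ne; congr (Posz (nat_of_ord _)); rewrite -(permK pi q); congr (_ _); apply: val_inj.
move=> s4 [b4 _ a54 _ A4].
have WTP e : (e < n)%N -> arrs s4 4 e%:Z = keyP e /\ (keyP e <= n)%N.
  move=> en; rewrite -[e]/(nat_of_ord (Ordinal en)) on_natE A4 ?ltn_ord //.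
  by split=> //; exact: ltnW (ltn_ord _).
rewrite -a54 in A52'.
apply: (terminates_weaken
    (merge_sortP n_gt1 small_exp keyP_inj (compareY A52') WTP b4 erefl erefl)) => //.
move=> s [bs a4 _ _ [hL hS]]; split=> // i.
- by rewrite a4 A4.
- by rewrite hL // on_natE cnt_ord // ltnW.
- by rewrite hS // on_natE below_ord // ltnW.
Qed.

Variables (term num den : expr).
Hypothesis deg_term : (deg sort_env term <= 59)%N.
Hypothesis deg_add : (deg_cmd sort_env (add_term term ;; Assign 2 (Var 2 +' Const 1)) <= 200)%N.
Hypothesis deg_out : (deg_cmd sort_env (output num den) <= 200)%N.
Hypothesis safe_exprs : forall s, [&& safe X Y s term, safe X Y s num & safe X Y s den].
Variables (T : 'I_n -> int) (num_value den_value : int).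
Hypothesis termP : forall s (i : 'I_n), vars s 2 = i%:Z ->
  arrs s 4 i%:Z = (pi i)%:Z -> arrs s 2 i%:Z = (lower_left i)%:Z ->
  arrs s 3 i%:Z = (lower_left_sum i)%:Z ->
  vars s 14 = (\sum_(j < n | (j < i)%N) pi j)%N%:Z -> ev X Y s term = T i.
Hypothesis numP : forall s, vars s 12 = \sum_i T i -> ev X Y s num = num_value.
Hypothesis denP : forall s, ev X Y s den = den_value.

Lemma sum_rank_le k : (\sum_(j < n | (j < k)%N) pi j <= n ^ 2)%N.
Proof.
rewrite big_mkcond; apply: (@leq_trans (\sum_(j < n) n)%N).
  by apply: leq_sum => j _; case: ifP => // _; exact: ltnW.
by rewrite sum_nat_const card_ord expnS expn1.
Qed.

Lemma terminates_program :
  terminates X Y w (program term num den) init_state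
    (program_cost term num den * (n * (trunc_log 2 n).+1))
    (fun s => vars s 0 = num_value /\ vars s 1 = den_value).
Proof.
set l := (trunc_log 2 n).+1.
have n_n2 : (n <= n ^ 2)%N by rewrite expnS expn1; nia.
apply: (terminates_weaken (Q := fun s => vars s 0 = num_value /\ vars s 1 = den_value)
  (T := (sort_cost true + (for_cost 2 store_order + (sort_cost false +
      (for_cost 2 store_rank + sort_cost false)))) * (n * l) +
    (worst clear_sums + (for_cost 2 (add_term term) * n + worst (output num den))))) => //; last first.
  by apply: program_cost_le => //; exact: ltnW.
apply: (@terminates_seq _ _ _ _ _ _ _ _ _ _ ranked); first exact: rank_passesP.
move=> s1 [b1 y1 L1 S1].
apply: (@terminates_seq _ _ _ _ _ _ _ _ _ _
   (fun s => [/\ ranked s, vars s 12 = 0 & vars s 14 = 0])).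
  apply: (terminates_run n_gt1 (E := sort_env)) => //; first exact: small_exp.
  split=> //=; split=> //; apply: bounded_var => //.
  by case: b1 => bv ba; split=> //= x; have := bv x; rewrite /=; case: eqP.
move=> s2 [r2 v12 v14].
(* The syntactic exponent would grow with each addition, so the running sum needs its own bound:
   [k * n ^ 59] after [k] rounds stays within the [n ^ 60] granted to variable 12. *)
pose I k s := [/\ ranked s, vars s 2 = k%:Z, vars s 12 = \sum_(i < n | (i < k)%N) T i,
  vars s 14 = (\sum_(j < n | (j < k)%N) pi j)%N%:Z &
  (`|vars s 12| <= k * n ^ 59)%N /\ (k <= n)%N].
have safe_term s : safe X Y s term by case/and3P: (safe_exprs s).
apply: (@terminates_seq _ _ _ _ _ _ _ _ _ _ (I n)).
  apply: (terminates_for_cost n_gt1 small_exp (I := I)) => //.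
  - by case: r2.
  - case: r2 => b2 y2 L2 S2; split=> //=.
    + by split=> //; exact: bounded_var.
    + by rewrite v12 big_pred0.
    + by rewrite v14 big_pred0.
    + by rewrite v12.
  - by move=> k s' [[? ? ? ?] ? ? ? ?].
  - move=> k s' k_n [[b2 y2 L2 S2] v2 v12' v14' [acc_le _]].
    split; first by rewrite /= safe_term.
    have term_le := leq_trans (ev_bounded n_gt1 b2 (safe_term s'))
      (leq_pexp2l (ltnW n_gt1) deg_term).
    pose i := Ordinal k_n.
    have evT : ev X Y s' term = T i by apply: termP.
    have sumS (V : nmodType) (F : 'I_n -> V) :
        \sum_(j < n | (j < k.+1)%N) F j = \sum_(j < n | (j < k)%N) F j + F i.
      rewrite (bigD1 i) //= addrC; congr (_ + _); apply: eq_bigl => j.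
      by rewrite ltnS leq_eqVlt andbC -val_eqE /=; case: eqP => //= ->; rewrite ltnn.
    have sum_le : (`|(vars s' 12 + T i)%R| <= k.+1 * n ^ 59)%N.
      by apply: leq_trans (abszD_le _ _) _; rewrite mulSn -evT addnC leq_add.
    have pow60 : (k.+1 * n ^ 59 <= n ^ 60)%N by rewrite [X in (_ <= X)%N]expnS leq_mul.
    have sum_le60 := leq_trans sum_le pow60.
    split; rewrite /= ?evT.
    + split=> //=.
      clear acc_le term_le pow60 sum_le.
      apply: bounded_var => //; last by rewrite v2; apply: small_cst => //; clear sum_le60; lia.
      apply: bounded_var => //; last first.
        rewrite v14' v2 (y2 i); apply: small_sq => //; clear sum_le60.
        have := sum_rank_le k; have := ltn_ord (pi i); lia.
      case: b2 => bv ba; split=> //= x; have := bv x; rewrite /=.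
      by case: eqP.
    + by rewrite v2; lia.
    + by rewrite v12' sumS.
    + rewrite v14' v2 (y2 i) -PoszD; congr Posz.
      exact/esym/(sumS nat (fun j => nat_of_ord (pi j))).
    + by split.
move=> s3 [[b3 _ _ _] v23 v123 _ _].
have vT : vars s3 12 = \sum_i T i.
  by rewrite v123; apply: eq_bigl => j; rewrite ltn_ord.
apply: (terminates_run n_gt1 (E := sort_env)) => //; first exact: small_exp.
  by rewrite /=; case/and3P: (safe_exprs s3) => _ -> _; case/and3P: (safe_exprs (set_var s3 0 (ev X Y s3 num))).
by split; rewrite /= ?(numP vT) ?denP.
Qed.

End Program.

(** * Concordant quadruples *)

Definition chi (b : bool) : int := (nat_of_bool b)%:Z.

Lemma chiM a b : chi (a && b) = chi a * chi b.
Proof. by case: a; case: b. Qed.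

Lemma sum_sym2 (T : finType) (F : T -> T -> int) :
  2 * (\sum_a \sum_b F a b) = \sum_a \sum_b (F a b + F b a).
Proof.
rewrite mulr_natl mulr2n; under [RHS]eq_bigr do rewrite big_split /=.
by rewrite big_split /= [X in _ = _ + X]exchange_big.
Qed.

Lemma sum_diag (T : finType) (a : T) (F : T -> int) :
  \sum_b chi (a == b) * F b = F a.
Proof.
rewrite (bigD1 a) //= eqxx mul1r big1 ?addr0 // => b ne.
by rewrite eq_sym (negPf ne) mul0r.
Qed.

Lemma chi_min3 (x y z : nat) : x != y -> x != z -> y != z ->
  chi true = chi ((x < y)%N && (x < z)%N) + chi ((y < x)%N && (y < z)%N)
    + chi ((z < x)%N && (z < y)%N).
Proof. by rewrite /chi; case: ltngtP; case: ltngtP; case: ltngtP => //=; lia. Qed.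

(** Five exclusive cases: [m] coincides with [l] or lies in one of the four gaps determined by
    [l < c < d]. *)
Lemma chi_insert (l c d m : nat) : m != c -> m != d ->
  chi ((l < c)%N && (c < d)%N) =
    chi ((l == m) && (l < c)%N && (l < d)%N && (c < d)%N) +
    (chi [&& (m < l)%N, (l < c)%N & (c < d)%N] + chi [&& (l < m)%N, (m < c)%N & (c < d)%N]
     + chi [&& (l < c)%N, (c < m)%N & (m < d)%N] + chi [&& (l < c)%N, (c < d)%N & (d < m)%N]).
Proof.
rewrite /chi; case: (ltngtP l c) => //= lc; case: (ltngtP c d) => //= cd;
  case: (ltngtP m c) => //= mc; case: (ltngtP m d) => //= md;
  case: (ltngtP m l) => //= ml; case: (ltngtP l d) => //= ld; lia.
Qed.

Lemma chi_max3 (x y z : nat) : x != y -> x != z -> y != z ->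
  chi true = chi ((x < z)%N && (y < z)%N) + chi ((x < y)%N && (z < y)%N)
    + chi ((y < x)%N && (z < x)%N).
Proof. by rewrite /chi; case: ltngtP; case: ltngtP; case: ltngtP => //=; lia. Qed.

(** Mirror image of [chi_insert], where [m] may coincide with the largest of the three. *)
Lemma chi_insert_rev (i j l m : nat) : m != i -> m != j ->
  chi ((i < j)%N && (j < l)%N) =
    chi ((l == m) && (i < l)%N && (j < l)%N && (i < j)%N) +
    (chi [&& (i < j)%N, (j < l)%N & (l < m)%N] + chi [&& (i < j)%N, (j < m)%N & (m < l)%N]
     + chi [&& (i < m)%N, (m < j)%N & (j < l)%N] + chi [&& (m < i)%N, (i < j)%N & (j < l)%N]).
Proof.
rewrite /chi; case: (ltngtP i j) => //= ij; case: (ltngtP j l) => //= jl;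
  case: (ltngtP m i) => //= mi; case: (ltngtP m j) => //= mj;
  case: (ltngtP m l) => //= ml; case: (ltngtP i l) => //= il; lia.
Qed.

(** On 2 x 2 bit matrices the right-hand side is 1 for the two constant ones, -1 for the two
    permutation matrices and 0 otherwise. A permutation matrix would give a cycle such as
    [x < z <= y < t <= x]. *)
Lemma chi_concordant (x y z t : nat) :
  chi [&& (x < z)%N == (x < t)%N, (x < z)%N == (y < z)%N & (x < z)%N == (y < t)%N] =
  1 - (chi (x < z)%N + chi (x < t)%N + chi (y < z)%N + chi (y < t)%N)
  + chi ((x < z)%N && (x < t)%N) + chi ((y < z)%N && (y < t)%N)
  + chi ((x < z)%N && (y < z)%N) + chi ((x < t)%N && (y < t)%N).
Proof.
by rewrite /chi; case: (ltnP x z); case: (ltnP x t); case: (ltnP y z);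
  case: (ltnP y t) => //=; lia.
Qed.

Lemma insertion_sub (T F1 F2 F3 F4 : int) :
  F1 = T + (F1 + F2 + F3 + F4) - (F2 + F3 + F4) - T.
Proof. lia. Qed.

Section Counting.
Variables (n : nat) (p : 'S_n).
Implicit Types (a b c d i j : 'I_n).

Lemma p_eq i j : (nat_of_ord (p i) == nat_of_ord (p j)) = (nat_of_ord i == nat_of_ord j).
Proof. by rewrite !val_eqE (inj_eq perm_inj). Qed.

Lemma p_neq i j : (i < j)%N -> (p i : nat) != p j.
Proof. by rewrite p_eq; lia. Qed.

(** * Counts and sums around one point *)

Lemma sum_lt_l i : \sum_(j < n) chi (j < i)%N = i%:Z.
Proof.
rewrite -[in RHS](sum_ord_lt (ltnW (ltn_ord i))).
by rewrite (big_morph Posz PoszD (erefl _)).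
Qed.

Lemma sum_plt_l i : \sum_(j < n) chi (p j < p i)%N = (p i)%:Z.
Proof.
rewrite -[in RHS](sum_perm_lt p (ltnW (ltn_ord (p i)))).
by rewrite (big_morph Posz PoszD (erefl _)).
Qed.

Lemma sum_one : \sum_(j : 'I_n) (1 : int) = n%:Z.
Proof. by rewrite sumr_const card_ord natz. Qed.

Lemma sum_lt_r i : \sum_(j < n) chi (i < j)%N = n%:Z - 1 - i%:Z.
Proof.
rewrite -sum_lt_l -sum_one -[X in _ - X - _](sum_diag i (fun=> 1)) -!sumrB.
by apply: eq_bigr => j _; rewrite mulr1 /chi -val_eqE /=; lia.
Qed.

Lemma sum_plt_r i : \sum_(j < n) chi (p i < p j)%N = n%:Z - 1 - (p i)%:Z.
Proof.
rewrite -sum_plt_l -sum_one -[X in _ - X - _](sum_diag i (fun=> 1)) -!sumrB.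
by apply: eq_bigr => j _; rewrite mulr1 /chi -val_eqE /= -p_eq; lia.
Qed.

Lemma sum_val_lt i : 2 * (\sum_(j < n) chi (j < i)%N * j%:Z) = i%:Z * (i%:Z - 1).
Proof.
under eq_bigr => j _ do rewrite -sum_lt_l mulr_sumr.
rewrite sum_sym2.
transitivity (\sum_(a < n) \sum_(b < n) (chi (a < i)%N * chi (b < i)%N - chi (a == b) * chi (b < i)%N)).
  apply: eq_bigr => a _; apply: eq_bigr => b _.
  by rewrite -!chiM /chi -val_eqE /=; lia.
under eq_bigr do rewrite sumrB -mulr_sumr sum_diag sum_lt_l.
by rewrite sumrB -mulr_suml sum_lt_l mulrBr mulr1.
Qed.

Lemma sum_plt_val i : 2 * (\sum_(j < n) chi (p j < p i)%N * (p j)%:Z) = (p i)%:Z * ((p i)%:Z - 1).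
Proof.
by rewrite -sum_val_lt [in RHS](reindex_inj (h := p)) //; exact: perm_inj.
Qed.

Lemma pairs_lt (u : 'I_n -> bool) (U := \sum_(a < n) chi (u a)) :
  2 * (\sum_(a < n) \sum_(b < n) chi [&& u a, u b & (a < b)%N]) = U * (U - 1).
Proof.
rewrite sum_sym2.
transitivity (\sum_(a < n) \sum_(b < n) (chi (u a) * chi (u b) - chi (a == b) * chi (u b))).
  apply: eq_bigr => a _; apply: eq_bigr => b _.
  rewrite -!chiM /chi; have [<-|] := eqVneq a b; first by lia.
  by rewrite -val_eqE /=; lia.
under eq_bigr do rewrite sumrB -mulr_sumr sum_diag.
by rewrite sumrB -mulr_suml -/U mulrBr mulr1.
Qed.

Definition lower i : int := \sum_(j < n) chi ((p j < p i)%N && (j < i)%N).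
Definition lower_sum i : int := \sum_(j < n) chi ((p j < p i)%N && (j < i)%N) * (p j)%:Z.
Definition prefix_sum i : int := \sum_(j < n) chi (j < i)%N * (p j)%:Z.
Definition upper i : int := \sum_(j < n) chi ((p i < p j)%N && (i < j)%N).

(** Of the [p i] points with smaller value, those not counted by [lower i] lie to the right of [i],
    where they are exactly the points missing from [upper i]. *)
Lemma upperE i : upper i = n%:Z - 1 - i%:Z - (p i)%:Z + lower i.
Proof.
rewrite -(sum_lt_r i) -(sum_plt_l i) /lower -sumrB -big_split /=.
by apply: eq_bigr => j _; have := p_eq i j; rewrite /chi; lia.
Qed.

Definition left_max i : int := \sum_(j < n) chi (j < i)%N * (\sum_(m < n) chi ((p j < p m)%N && (p i < p m)%N)).

(** The inner sum is [n - 1] minus the maximum of [p i] and [p j]. This maximum is [p i] for the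
    [lower i] smaller predecessors; over the other predecessors it is [p j], with total
    [prefix_sum i - lower_sum i]. *)
Lemma left_maxE i : left_max i = lower i * (n%:Z - 1 - (p i)%:Z)
  + (n%:Z - 1) * (i%:Z - lower i) - prefix_sum i + lower_sum i.
Proof.
rewrite -(sum_lt_l i) /left_max /prefix_sum /lower_sum /lower [(_ - 1) * _]mulrBr.
rewrite !mulr_suml !mulr_sumr -sumrB -big_split -sumrB -big_split /=.
apply: eq_bigr => j _.
have [ij|ij] := boolP (j < i)%N; last by rewrite /chi !andbF; lia.
rewrite andbT; have [pij|pij] := boolP (p j < p i)%N.
  rewrite (_ : \sum_(m < n) _ = n%:Z - 1 - (p i)%:Z) /chi /=; first by lia.
  rewrite -sum_plt_r; apply: eq_bigr => m _; rewrite /chi; lia.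
rewrite (_ : \sum_(m < n) _ = n%:Z - 1 - (p j)%:Z) /chi /=; first by lia.
have := p_eq i j; rewrite -sum_plt_r => h; apply: eq_bigr => m _; rewrite /chi; lia.
Qed.

(** * Sums over quadruples *)

Definition sum4 (F : 'I_n -> 'I_n -> 'I_n -> 'I_n -> int) : int :=
  \sum_(a < n) \sum_(b < n) \sum_(c < n) \sum_(d < n) F a b c d.

Lemma eq_sum4 F G : (forall a b c d, F a b c d = G a b c d) -> sum4 F = sum4 G.
Proof. by move=> FG; do 4 (apply: eq_bigr => ? _); exact: FG. Qed.

Lemma sum4_swap12 F : sum4 (fun a b c d => F b a c d) = sum4 F.
Proof. exact: exchange_big. Qed.

Lemma sum4_swap23 F : sum4 (fun a b c d => F a c b d) = sum4 F.
Proof. by apply: eq_bigr => a _; exact: exchange_big. Qed.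

Lemma sum4_swap34 F : sum4 (fun a b c d => F a b d c) = sum4 F.
Proof. by apply: eq_bigr => a _; apply: eq_bigr => b _; exact: exchange_big. Qed.

Lemma sum4D F G : sum4 (fun a b c d => F a b c d + G a b c d) = sum4 F + sum4 G.
Proof.
rewrite /sum4 -big_split; apply: eq_bigr => a _; rewrite -big_split; apply: eq_bigr => b _.
by rewrite -big_split; apply: eq_bigr => c _; rewrite -big_split.
Qed.

Lemma sum4N F : sum4 (fun a b c d => - F a b c d) = - sum4 F.
Proof.
by rewrite /sum4 -sumrN; apply: eq_bigr => a _; rewrite -sumrN; apply: eq_bigr => b _;
  rewrite -sumrN; apply: eq_bigr => c _; rewrite -sumrN.
Qed.

Definition quad a b c d : bool := [&& (a < b)%N, (b < c)%N & (c < d)%N].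
Definition quads : int := sum4 (fun a b c d => chi (quad a b c d)).

Lemma hockey_stick m k : (\sum_(i < m) 'C(i, k) = 'C(m, k.+1))%N.
Proof. by elim: m => [|m IH]; rewrite ?big_ord0 // big_ord_recr /= IH binS. Qed.

Lemma sum_lt_bin m k : (m <= n)%N ->
  \sum_(i < n) chi (i < m)%N * 'C(i, k)%:Z = 'C(m, k.+1)%:Z.
Proof.
move=> mn; rewrite -hockey_stick (big_ord_widen n (fun i : nat => 'C(i, k)) mn).
rewrite (big_morph Posz PoszD (erefl _)) [RHS]big_mkcond.
by apply: eq_bigr => i _; rewrite /chi; case: (i < m)%N; rewrite ?mul1r ?mul0r.
Qed.

Lemma quadsE : quads = 'C(n, 4)%:Z.
Proof.
rewrite -[RHS](sum_lt_bin 3 (leqnn n)) /quads.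
(* The swaps reverse the order of summation, so that each inner sum runs below the next outer index
   and the hockey-stick identity applies level by level. *)
rewrite -sum4_swap12 -sum4_swap23 -sum4_swap34 -sum4_swap12 -sum4_swap23 -sum4_swap12.
apply: eq_bigr => d _; rewrite ltn_ord mul1r -(sum_lt_bin 2 (ltnW (ltn_ord d))).
apply: eq_bigr => c _; rewrite -(sum_lt_bin 1 (ltnW (ltn_ord c))) mulr_sumr.
apply: eq_bigr => b _; rewrite bin1 -(sum_lt_l b) !mulr_sumr.
by apply: eq_bigr => a _; rewrite -!chiM /quad; congr chi; lia.
Qed.

Definition upper_pairs l : int := \sum_(c < n) \sum_(d < n)
  chi [&& (p l < p c)%N && (l < c)%N, (p l < p d)%N && (l < d)%N & (c < d)%N].

Definition lower_pairs l : int := \sum_(i < n) \sum_(j < n)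
  chi [&& (p i < p l)%N && (i < l)%N, (p j < p l)%N && (j < l)%N & (i < j)%N].

Lemma upper_pairsE l : 2 * upper_pairs l = upper l * (upper l - 1).
Proof. exact: pairs_lt. Qed.

Lemma lower_pairsE l : 2 * lower_pairs l = lower l * (lower l - 1).
Proof. exact: pairs_lt. Qed.

(* A pair [c < d] is extended by a position [l] to its left and a value [m]
   below it; inserting [m] among the positions [l < c < d] yields a quadruple. *)
Definition low_pairs : int :=
  \sum_(c < n) \sum_(d < n) chi (c < d)%N *
    (c%:Z * \sum_(m < n) chi ((p m < p c)%N && (p m < p d)%N)).

(** Depending on its gap, [m] becomes the first, second, third or fourth position of a quadruple.
    The first case is the wanted count. In the other three, [m] has the smallest value among the
    last three positions, so together they count every quadruple once. The coincidence [m = l]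
    contributes [upper_pairs l]. *)
Lemma quads_first_low :
  sum4 (fun a b c d => chi [&& quad a b c d, (p a < p c)%N & (p a < p d)%N]) =
  low_pairs - quads -
  \sum_(l < n) upper_pairs l.
Proof.
suff : low_pairs =
  \sum_(l < n) upper_pairs l +
  (sum4 (fun a b c d => chi [&& quad a b c d, (p a < p c)%N & (p a < p d)%N]) +
   sum4 (fun a b c d => chi [&& quad a b c d, (p b < p c)%N & (p b < p d)%N]) +
   sum4 (fun a b c d => chi [&& quad a b c d, (p c < p b)%N & (p c < p d)%N]) +
   sum4 (fun a b c d => chi [&& quad a b c d, (p d < p b)%N & (p d < p c)%N])).
  have -> : quads =
    sum4 (fun a b c d => chi [&& quad a b c d, (p b < p c)%N & (p b < p d)%N]) +
    sum4 (fun a b c d => chi [&& quad a b c d, (p c < p b)%N & (p c < p d)%N]) +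
    sum4 (fun a b c d => chi [&& quad a b c d, (p d < p b)%N & (p d < p c)%N]).
    rewrite -!sum4D; apply: eq_sum4 => a b c d.
    have [/and3P[_ bc cd]|] := boolP (quad a b c d); last by [].
    exact: chi_min3 (p_neq bc) (p_neq (ltn_trans bc cd)) (p_neq cd).
  by move=> ->; exact: insertion_sub.
pose G l c d m := chi [&& (l < c)%N, (c < d)%N, (p m < p c)%N & (p m < p d)%N].
have -> : low_pairs = sum4 G.
  transitivity (\sum_(c < n) \sum_(d < n) \sum_(l < n) \sum_(m < n) G l c d m).
    apply: eq_bigr => c _; apply: eq_bigr => d _.
    rewrite -sum_lt_l mulr_suml mulr_sumr; apply: eq_bigr => l _.
    by rewrite !mulr_sumr; apply: eq_bigr => m _; rewrite -!chiM /G; congr chi; lia.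
  rewrite exchange_big /=; under eq_bigr do rewrite exchange_big /=.
  rewrite exchange_big /=; apply: eq_bigr => l _; exact: exchange_big.
rewrite -[X in _ = _ + (X + _ + _ + _)]sum4_swap12.
rewrite -[X in _ = _ + (X + _ + _ + _)]sum4_swap23.
rewrite -[X in _ = _ + (X + _ + _ + _)]sum4_swap34.
rewrite -[X in _ = _ + (_ + X + _ + _)]sum4_swap23.
rewrite -[X in _ = _ + (_ + X + _ + _)]sum4_swap34.
rewrite -[X in _ = _ + (_ + _ + X + _)]sum4_swap34.
rewrite -!sum4D /sum4 -big_split; apply: eq_bigr => l _.
rewrite -big_split; apply: eq_bigr => c _; rewrite -big_split; apply: eq_bigr => d _ /=.
rewrite -[X in _ = X + _](sum_diag l (fun m => chi [&& (p m < p c)%N && (l < c)%N,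
    (p m < p d)%N && (l < d)%N & (c < d)%N])) -big_split.
apply: eq_bigr => m _ /=; rewrite -chiM -val_eqE /= /G.
have [/andP[mc md]|] := boolP ((p m < p c)%N && (p m < p d)%N); last first.
  by case: (p m < p c)%N => /=; case: (p m < p d)%N => //= _; rewrite !andbF.
rewrite mc md /= !andbT !andbA.
by apply: chi_insert; rewrite -p_eq; lia.
Qed.

(** Counterpart of [low_pairs] under reversal of positions and values: [j] is the later position of
    the pair, the factor counts the positions [l] to its right, and [left_max] counts the earlier
    position together with a value above both. *)
Definition high_pairs : int :=
  \sum_(j < n) (n%:Z - 1 - j%:Z) * left_max j.

Lemma high_pairs_sum4 : high_pairs =
  sum4 (fun l i j m => chi [&& (i < j)%N, (j < l)%N, (p i < p m)%N & (p j < p m)%N]).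
Proof.
pose G (l i j m : 'I_n) := chi [&& (i < j)%N, (j < l)%N, (p i < p m)%N & (p j < p m)%N].
transitivity (\sum_(j < n) \sum_(i < n) \sum_(l < n) \sum_(m < n) G l i j m).
  apply: eq_bigr => j _; rewrite mulr_sumr; apply: eq_bigr => i _.
  rewrite -sum_lt_r mulr_suml; apply: eq_bigr => l _.
  rewrite !mulr_sumr; apply: eq_bigr => m _; rewrite -!chiM /G; congr chi.
  by rewrite andbCA !andbA.
rewrite exchange_big /=; under eq_bigr do rewrite exchange_big /=.
rewrite exchange_big /=; apply: eq_bigr => l _; exact: eq_bigr.
Qed.

(** The argument of [quads_first_low] reversed: now [m] has the largest value among the first three
    positions in the three cases that add up to [quads], and [m = l] contributes [lower_pairs l]. *)
Lemma quads_last_high :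
  sum4 (fun a b c d => chi [&& quad a b c d, (p a < p d)%N & (p b < p d)%N]) =
  high_pairs - quads -
  \sum_(l < n) lower_pairs l.
Proof.
suff : high_pairs =
  \sum_(l < n) lower_pairs l +
  (sum4 (fun a b c d => chi [&& quad a b c d, (p a < p d)%N & (p b < p d)%N]) +
   sum4 (fun a b c d => chi [&& quad a b c d, (p a < p c)%N & (p b < p c)%N]) +
   sum4 (fun a b c d => chi [&& quad a b c d, (p a < p b)%N & (p c < p b)%N]) +
   sum4 (fun a b c d => chi [&& quad a b c d, (p b < p a)%N & (p c < p a)%N])).
  have -> : quads =
    sum4 (fun a b c d => chi [&& quad a b c d, (p a < p c)%N & (p b < p c)%N]) +
    sum4 (fun a b c d => chi [&& quad a b c d, (p a < p b)%N & (p c < p b)%N]) +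
    sum4 (fun a b c d => chi [&& quad a b c d, (p b < p a)%N & (p c < p a)%N]).
    rewrite -!sum4D; apply: eq_sum4 => a b c d.
    have [/and3P[ab bc _]|] := boolP (quad a b c d); last by [].
    exact: chi_max3 (p_neq ab) (p_neq (ltn_trans ab bc)) (p_neq bc).
  by move=> ->; exact: insertion_sub.
rewrite high_pairs_sum4.
rewrite -[X in _ = _ + (X + _ + _ + _)]sum4_swap23.
rewrite -[X in _ = _ + (X + _ + _ + _)]sum4_swap12.
rewrite -[X in _ = _ + (_ + X + _ + _)]sum4_swap34.
rewrite -[X in _ = _ + (_ + X + _ + _)]sum4_swap23.
rewrite -[X in _ = _ + (_ + X + _ + _)]sum4_swap12.
rewrite -[X in _ = _ + (_ + _ + X + _)]sum4_swap23.
rewrite -[X in _ = _ + (_ + _ + X + _)]sum4_swap34.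
rewrite -[X in _ = _ + (_ + _ + X + _)]sum4_swap23.
rewrite -[X in _ = _ + (_ + _ + X + _)]sum4_swap12.
rewrite -[X in _ = _ + (_ + _ + _ + X)]sum4_swap12.
rewrite -[X in _ = _ + (_ + _ + _ + X)]sum4_swap23.
rewrite -[X in _ = _ + (_ + _ + _ + X)]sum4_swap34.
rewrite -[X in _ = _ + (_ + _ + _ + X)]sum4_swap23.
rewrite -[X in _ = _ + (_ + _ + _ + X)]sum4_swap12.
rewrite -!sum4D /sum4 -big_split; apply: eq_bigr => l _.
rewrite -big_split; apply: eq_bigr => i _; rewrite -big_split; apply: eq_bigr => j _ /=.
rewrite -[X in _ = X + _](sum_diag l (fun m => chi [&& (p i < p m)%N && (i < l)%N,
    (p j < p m)%N && (j < l)%N & (i < j)%N])) -big_split.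
apply: eq_bigr => m _ /=; rewrite -chiM -val_eqE /=.
have [/andP[im jm]|] := boolP ((p i < p m)%N && (p j < p m)%N); last first.
  by case: (p i < p m)%N => /=; case: (p j < p m)%N => //= _; rewrite !andbF.
rewrite im jm /= !andbT !andbA.
by apply: chi_insert_rev; rewrite -p_eq; lia.
Qed.

(** The free position [a] and the pair [c < d] lie on opposite sides of [b], so their counts
    multiply; the same holds around [c] in [quads_third_high]. *)
Lemma quads_second_low :
  sum4 (fun a b c d => chi [&& quad a b c d, (p b < p c)%N & (p b < p d)%N]) =
  \sum_(b < n) b%:Z * upper_pairs b.
Proof.
rewrite -sum4_swap12; apply: eq_bigr => b _.
rewrite -sum_lt_l mulr_suml; apply: eq_bigr => a _; rewrite mulr_sumr.
apply: eq_bigr => c _; rewrite mulr_sumr; apply: eq_bigr => d _.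
rewrite -chiM /quad; congr chi.
case: (ltnP b c) => bc; rewrite ?andbF //; case: (ltnP c d) => cd; rewrite ?andbF //.
by rewrite (ltn_trans bc cd) !andbT.
Qed.

Lemma quads_third_high :
  sum4 (fun a b c d => chi [&& quad a b c d, (p a < p c)%N & (p b < p c)%N]) =
  \sum_(c < n) (n%:Z - 1 - c%:Z) * lower_pairs c.
Proof.
rewrite -sum4_swap23 -sum4_swap12; apply: eq_bigr => c _.
rewrite mulr_sumr; apply: eq_bigr => a _; rewrite mulr_sumr.
apply: eq_bigr => b _; rewrite -sum_lt_r mulr_suml; apply: eq_bigr => d _.
rewrite -chiM /quad; congr chi.
case: (ltnP a b) => ab; rewrite ?andbF //; case: (ltnP b c) => bc; rewrite ?andbF //.
by rewrite (ltn_trans ab bc) !andbT /= andbC.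
Qed.

(** * Quadruples with one prescribed comparison *)

Definition asc i j : bool := (p i < p j)%N && (i < j)%N.

Lemma sum_between i j : (i < j)%N ->
  \sum_(b < n) chi ((i < b)%N && (b < j)%N) = j%:Z - i%:Z - 1.
Proof.
move=> ij; rewrite -!sum_lt_l -[X in _ - X](sum_diag i (fun=> 1)) -!sumrB.
by apply: eq_bigr => b _; rewrite mulr1 /chi -val_eqE /=; lia.
Qed.

Lemma sum_asc (F : 'I_n -> 'I_n -> 'I_n -> 'I_n -> int) (w : 'I_n -> 'I_n -> int) :
  (forall i j, (i < j)%N -> \sum_(k < n) \sum_(l < n) F i j k l = w i j) ->
  sum4 (fun i j k l => chi (asc i j) * F i j k l) =
  \sum_(i < n) \sum_(j < n) chi (asc i j) * w i j.
Proof.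
move=> Fw; apply: eq_bigr => i _; apply: eq_bigr => j _.
under eq_bigr do rewrite -mulr_sumr.
rewrite -mulr_sumr /asc; case: (ltnP i j) => [ij|_]; first by rewrite Fw.
by rewrite andbF !mul0r.
Qed.

(** Fix the compared pair [i < j]. Its four roles are all but two of the six possible ones: excluded
    are the first two places, with both other points after [j], and the last two, with both before
    [i]. Hence twice the number of completions is [w i j] below. It splits into a part in [i] and a
    part in [j], so the sum over ascents needs only [upper] and [lower]. *)
Lemma quads_asc :
  2 * (sum4 (fun a b c d => chi (quad a b c d && (p a < p c)%N)) +
       sum4 (fun a b c d => chi (quad a b c d && (p a < p d)%N)) +
       sum4 (fun a b c d => chi (quad a b c d && (p b < p c)%N)) +
       sum4 (fun a b c d => chi (quad a b c d && (p b < p d)%N))) =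
  \sum_(i < n) (lower i * ((n%:Z - 2) * (n%:Z - 3) - (n%:Z - 1 - i%:Z) * (n%:Z - 2 - i%:Z))
                - i%:Z * (i%:Z - 1) * upper i).
Proof.
rewrite -sum4_swap23.
rewrite -[X in _ + X + _ + _]sum4_swap34 -[X in _ + X + _ + _]sum4_swap23.
rewrite -[X in _ + X + _]sum4_swap12 -[X in _ + X + _]sum4_swap23.
rewrite -[X in _ + X]sum4_swap12 -[X in _ + X]sum4_swap34.
rewrite -[X in _ + X]sum4_swap23.
rewrite -!sum4D mulr_natl mulr2n -sum4D.
pose between i j k := (i < k)%N && (k < j)%N.
(* Twice the completions by [k] and [l]: first the roles [ac] and [bc], then [bd], then [ad]. *)
pose F (i j k l : 'I_n) : int :=
  (chi (between i j k) + chi (k < i)%N) * (chi (j < l)%N + chi (j < l)%N)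
  + (chi (k < i)%N + chi (k < i)%N) * chi (between i j l)
  + (chi [&& between i j k, between i j l & (k < l)%N]
     + chi [&& between i j k, between i j l & (k < l)%N]).
pose w (i j : 'I_n) : int := (n%:Z - 2) * (n%:Z - 3)
  - (n%:Z - 1 - j%:Z) * (n%:Z - 2 - j%:Z) - i%:Z * (i%:Z - 1).
transitivity (sum4 (fun i j k l => chi (asc i j) * F i j k l)).
  apply: eq_sum4 => i j k l; rewrite /F /asc /quad /between.
  case: (p i < p j)%N; rewrite ?andbF ?andbT ?mul0r //=.
  rewrite /chi; case: (ltnP i j) => ij /=; last by lia.
  case: (ltnP i k) => ik /=; case: (ltnP k j) => kj /=; case: (ltnP k i) => ki /=;
    case: (ltnP j l) => jl /=; case: (ltnP i l) => il /=; case: (ltnP l j) => lj /=;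
    case: (ltnP k l) => kl /=; lia.
rewrite (sum_asc (w := w)).
  rewrite sumrB; under [X in _ = X - _]eq_bigr do rewrite /lower mulr_suml.
  under [X in _ = _ - X]eq_bigr do rewrite /upper mulr_sumr.
  rewrite [X in _ = X - _]exchange_big -sumrB; apply: eq_bigr => i _ /=.
  by rewrite -sumrB; apply: eq_bigr => j _; rewrite /asc /w; ring.
move=> i j ij; have btw := sum_between ij.
have pairs := pairs_lt (between i j); rewrite /= btw in pairs.
under eq_bigr do rewrite big_split big_split big_split /= -!mulr_sumr btw big_split /= sum_lt_r.
rewrite !big_split /= -!mulr_suml !big_split /= btw sum_lt_l.
by rewrite -[X in _ + X = _]mulr2n -mulr_natl pairs /w; ring.
Qed.

(* The sign pattern of a quadruple avoids the two diagonal matrices, so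
   concordance is a polynomial of degree two in the four comparisons. *)
Definition concordant a b c d : bool :=
  [&& (p a < p c)%N == (p a < p d)%N, (p a < p c)%N == (p b < p c)%N
    & (p a < p c)%N == (p b < p d)%N].

Definition concordant_quads : int :=
  sum4 (fun a b c d => chi (quad a b c d && concordant a b c d)).

(** [U] is [upper p i]. The first two products come from single comparisons, the third from
    [low_pairs], the last from [high_pairs]. In the factors of [U * (U - 1)] and [L * (L - 1)], with
    [L] for [lower p i], one unit is subtracted for the coincidences [m = l]. *)
Definition tau_term i : int :=
  let U := n%:Z - 1 - i%:Z - (p i)%:Z + lower i in
  i%:Z * (i%:Z - 1) * U
  - lower i * ((n%:Z - 2) * (n%:Z - 3) - (n%:Z - 1 - i%:Z) * (n%:Z - 2 - i%:Z))
  + i%:Z * (2 * (p i)%:Z * U + (p i)%:Z * ((p i)%:Z - 1) - 2 * lower_sum i)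
  + (i%:Z - 1) * U * (U - 1) + (n%:Z - 2 - i%:Z) * lower i * (lower i - 1)
  + 2 * (n%:Z - 1 - i%:Z) * (lower i * (n%:Z - 1 - (p i)%:Z)
      + (n%:Z - 1) * (i%:Z - lower i) - prefix_sum i + lower_sum i).

(** The number of values below both is the minimum of [p c] and [p d]. It is [p c] for the [upper c]
    larger successors; for the smaller ones the [p d] add up to the sum of all values below [p c]
    minus [lower_sum c]. *)
Lemma low_pairsE :
  2 * low_pairs = \sum_(i < n) i%:Z * (2 * (p i)%:Z * upper i +
     (p i)%:Z * ((p i)%:Z - 1) - 2 * lower_sum i).
Proof.
rewrite /low_pairs mulr_sumr; apply: eq_bigr => c _; rewrite -sum_plt_val.
suff -> : \sum_(d < n) chi (c < d)%N *
    (c%:Z * \sum_(m < n) chi ((p m < p c)%N && (p m < p d)%N)) =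
    c%:Z * ((p c)%:Z * upper c + (\sum_(j < n) chi (p j < p c)%N * (p j)%:Z - lower_sum c)).
  by ring.
rewrite /upper /lower_sum mulr_sumr -sumrB -big_split mulr_sumr /=.
apply: eq_bigr => d _.
rewrite mulrCA; congr (_ * _); have [pcd|pdc] := ltnP (p c) (p d).
  rewrite (_ : \sum_(m < n) _ = (p c)%:Z) 1?mulrC /chi; first by lia.
  by rewrite -sum_plt_l; apply: eq_bigr => m _; rewrite /chi; lia.
rewrite (_ : \sum_(m < n) _ = (p d)%:Z).
  have := p_eq c d; rewrite /chi; case: (ltngtP c d) => //= cd h.
  - by rewrite (_ : (p d < p c)%N) //; lia.
  - by case: (p d < p c)%N; lia.
  - by rewrite (_ : (p d < p c)%N = false) ?mul0r ?mulr0 //; lia.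
by rewrite -sum_plt_l; apply: eq_bigr => m _; rewrite /chi; lia.
Qed.

Lemma concordant_quadsE :
  2 * concordant_quads = \sum_(i < n) tau_term i - 2 * quads.
Proof.
have -> : concordant_quads = quads -
   (sum4 (fun a b c d => chi (quad a b c d && (p a < p c)%N)) +
    sum4 (fun a b c d => chi (quad a b c d && (p a < p d)%N)) +
    sum4 (fun a b c d => chi (quad a b c d && (p b < p c)%N)) +
    sum4 (fun a b c d => chi (quad a b c d && (p b < p d)%N)))
   + sum4 (fun a b c d => chi [&& quad a b c d, (p a < p c)%N & (p a < p d)%N])
   + sum4 (fun a b c d => chi [&& quad a b c d, (p b < p c)%N & (p b < p d)%N])
   + sum4 (fun a b c d => chi [&& quad a b c d, (p a < p c)%N & (p b < p c)%N])
   + sum4 (fun a b c d => chi [&& quad a b c d, (p a < p d)%N & (p b < p d)%N]).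
  rewrite /quads -!sum4D -sum4N -!sum4D; apply: eq_sum4 => a b c d.
  case: (quad a b c d) => //=; exact: chi_concordant.
rewrite quads_first_low quads_last_high quads_second_low quads_third_high.
have lin (q a4 lo up b c hi dn : int) :
  2 * (q - a4 + (lo - q - up) + b + c + (hi - q - dn)) =
  2 * lo - 2 * a4 + (2 * b - 2 * up) + (2 * c - 2 * dn) + 2 * hi - 2 * q by ring.
rewrite lin quads_asc low_pairsE; congr (_ - _).
rewrite /high_pairs !mulr_sumr -!sumrB -!big_split /=.
apply: eq_bigr => i _; rewrite /tau_term -left_maxE -upperE.
have -> : 2 * (i%:Z * upper_pairs i) = i%:Z * (upper i * (upper i - 1)).
  by rewrite -upper_pairsE mulrCA.
have -> : 2 * ((n%:Z - 1 - i%:Z) * lower_pairs i) =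
    (n%:Z - 1 - i%:Z) * (lower i * (lower i - 1)).
  by rewrite -lower_pairsE mulrCA.
rewrite upper_pairsE lower_pairsE; ring.
Qed.

End Counting.

(** * The statistic tau* *)

Lemma perm_order_inj k (s t : 'S_k) :
  (forall i j, (s i < s j)%N = (t i < t j)%N) -> s = t.
Proof.
move=> st; apply/permP => i; apply: val_inj => /=.
rewrite -(sum_perm_lt s (ltnW (ltn_ord (s i)))) -(sum_perm_lt t (ltnW (ltn_ord (t i)))).
by apply: eq_bigr => j _; rewrite st.
Qed.

Section Patterns.
Variables (k n : nat) (p : 'S_n).
Implicit Type x : {ffun 'I_k -> 'I_n}.

Definition matches (sigma : 'S_k) x : bool :=
  [forall i : 'I_k, forall j : 'I_k, (p (x i) < p (x j))%N == (sigma i < sigma j)%N].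

Definition increasing x : bool :=
  [forall i : 'I_k, forall j : 'I_k, (i < j)%N ==> (x i < x j)%N].

Lemma increasing_inj x : increasing x -> injective x.
Proof.
move=> /forallP inc i j xij; apply: val_inj => /=; apply/eqP.
have := implyP (forallP (inc i) j); have := implyP (forallP (inc j) i).
by rewrite xij ltnn; case: ltngtP => // _ h1 h2; first [by have := h1 isT | by have := h2 isT].
Qed.

(** The pattern is the ranking of the values along [x], read as reals so that [rank] applies. *)
Lemma pattern_exists (R : realType) x : injective x -> {s : 'S_k | matches s x}.
Proof.
move=> injx; pose Z i : R := (p (x i))%:R.
have injZ : injective Z.
  by move=> i j /eqP; rewrite /Z eqr_nat => /eqP /val_inj /perm_inj /injx.
exists (perm (rank_inj injZ)); apply/forallP => i; apply/forallP => j.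
by rewrite !permE rank_lt // /Z ltr_nat.
Qed.

Lemma matches_uniq s t x : matches s x -> matches t x -> s = t.
Proof.
move=> /forallP ms /forallP mt; apply: perm_order_inj => i j.
by rewrite -(eqP (forallP (ms i) j)) -(eqP (forallP (mt i) j)).
Qed.

(** Every increasing [x] matches exactly one pattern, so summing over patterns first leaves the
    indicator of [h]. *)
Lemma sum_occurrences (R : realType) (D : {set 'S_k}) (h : {ffun 'I_k -> 'I_n} -> bool) :
  (forall s x, matches s x -> (s \in D) = h x) ->
  (\sum_(s in D) occurrences s p)%N = (\sum_x (increasing x && h x))%N.
Proof.
move=> Dh; transitivity (\sum_(s in D) \sum_x (increasing x && matches s x))%N.
  apply: eq_bigr => s _; rewrite /occurrences -sum1_card big_mkcond /=.
  by apply: eq_bigr => x _; rewrite inE; case: ifP.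
rewrite exchange_big /=; apply: eq_bigr => x _.
have [inc|_] := boolP (increasing x); last by rewrite big1.
have [s ms] := pattern_exists R (increasing_inj inc).
have [hx|hx] := boolP (h x); last first.
  rewrite big1 // => t tD; case: (boolP (matches t x)) => //= mt.
  by move: hx; rewrite -(Dh _ _ mt) tD.
rewrite (bigD1 s) /=; last by rewrite (Dh _ _ ms).
rewrite ms big1 // => t /andP[_ ts]; case: (boolP (matches t x)) => //= mt.
by rewrite (matches_uniq mt ms) eqxx in ts.
Qed.

End Patterns.

Local Notation o0 := (@Ordinal 4 0 isT).
Local Notation o1 := (@Ordinal 4 1 isT).
Local Notation o2 := (@Ordinal 4 2 isT).
Local Notation o3 := (@Ordinal 4 3 isT).

Lemma forall_ord4 (P : pred 'I_4) :
  [forall i, P i] = [&& P o0, P o1, P o2 & P o3].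
Proof.
apply/forallP/and4P => [h|[h0 h1 h2 h3] i]; first by split.
by case: i => [[|[|[|[|i]]]] hi] //; rewrite (bool_irrelevance hi isT).
Qed.

Lemma enum_ord4 : enum 'I_4 = [:: o0; o1; o2; o3].
Proof. by apply: (inj_map val_inj); rewrite val_enum_ord. Qed.

Lemma mem_setC4 (s : 'S_4) : (s \in setC4) =
  [&& (s o0 < s o2)%N == (s o0 < s o3)%N, (s o0 < s o2)%N == (s o1 < s o2)%N
    & (s o0 < s o2)%N == (s o1 < s o3)%N].
Proof.
rewrite inE /one_line enum_ord4 /=.
(* Only the distinctness of the four values is kept; the equivalence is then checked on all value
   tuples. *)
have neq i j : i != j -> (s i : nat) != s j by rewrite p_eq.
have := neq o0 o1 isT; have := neq o0 o2 isT; have := neq o0 o3 isT.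
have := neq o1 o2 isT; have := neq o1 o3 isT; have := neq o2 o3 isT.
case: (s o0) => a ha; case: (s o1) => b hb; case: (s o2) => c hc; case: (s o3) => d hd /=.
move: a ha b hb c hc d hd.
do 4 (case=> [|[|[|[|?]]]] ? //).
Qed.

Lemma sum_ffun4 n (F : 'I_n -> 'I_n -> 'I_n -> 'I_n -> nat) :
  (\sum_(x : {ffun 'I_4 -> 'I_n}) F (x o0) (x o1) (x o2) (x o3) =
   \sum_(a < n) \sum_(b < n) \sum_(c < n) \sum_(d < n) F a b c d)%N.
Proof.
do 3 rewrite pair_bigA /=.
pose tup (x : {ffun 'I_4 -> 'I_n}) := (x o0, x o1, x o2, x o3).
pose fn (q : 'I_n * 'I_n * 'I_n * 'I_n) : {ffun 'I_4 -> 'I_n} :=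
  [ffun i : 'I_4 => nth q.2 [:: q.1.1.1; q.1.1.2; q.1.2] i].
rewrite [RHS](reindex tup) //; exists fn => [x _|[[[a b] c] d] _].
  apply/ffunP => i; rewrite ffunE /=.
  by case: i => [[|[|[|[|i]]]] hi] //=; congr (x _); apply: val_inj.
by rewrite /tup !ffunE.
Qed.

Lemma increasing4 n (x : {ffun 'I_4 -> 'I_n}) :
  increasing x = quad (x o0) (x o1) (x o2) (x o3).
Proof.
rewrite /increasing /quad !forall_ord4 /= !andbT.
apply/idP/idP; first by case/and3P => /and3P[-> _ _] /andP[-> _] ->.
case/and3P => h01 h12 h23.
by rewrite h01 h12 h23 (ltn_trans h01 h12) (ltn_trans h12 h23)
  (ltn_trans (ltn_trans h01 h12) h23).
Qed.

Section Concordance.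
Variables (R : realType) (n : nat) (p : 'S_n).

Lemma sum_occurrences4 (D : {set 'S_4}) (h : 'I_n -> 'I_n -> 'I_n -> 'I_n -> bool) :
  (forall (s : 'S_4) x, matches p s x -> (s \in D) = h (x o0) (x o1) (x o2) (x o3)) ->
  (\sum_(s in D) occurrences s p)%N%:Z =
    sum4 (fun a b c d => chi (quad a b c d && h a b c d)).
Proof.
move=> Dh; rewrite (sum_occurrences R Dh).
under eq_bigr do rewrite increasing4.
rewrite (sum_ffun4 (fun a b c d => nat_of_bool (quad a b c d && h a b c d))).
by do 4 (rewrite (big_morph Posz PoszD (erefl _)); apply: eq_bigr => ? _).
Qed.

Lemma sum_occurrencesC :
  (\sum_(s in setC4) occurrences s p)%N%:Z = concordant_quads p.
Proof.
apply: sum_occurrences4 => s x /forallP ms; rewrite mem_setC4 /concordant.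
by rewrite !(eqP (forallP (ms _) _)).
Qed.

Lemma sum_occurrences_all :
  (\sum_(s in setC4) occurrences s p + \sum_(s in setD4) occurrences s p)%N = 'C(n, 4).
Proof.
have := @sum_occurrences4 setT (fun _ _ _ _ => true).
move=> /(_ (fun s _ _ => in_setT s)) h; apply/eqP; rewrite -eqz_nat -quadsE.
rewrite (_ : quads n = (\sum_(s in [set: 'S_4]) occurrences s p)%N).
  apply/eqP; congr Posz; rewrite [RHS](bigID (mem setC4)) /=.
  by congr (_ + _)%N; apply: eq_bigl => s; rewrite !inE.
by rewrite h; apply: eq_sum4 => a b c d; rewrite andbT.
Qed.

End Concordance.

(** With [A] the number of concordant quadruples, tau* is [A / 'C(n, 4) - 1/3]. The fraction follows
    from the sum of the terms being [2 * A + 2 * 'C(n, 4)] and from [n4 = 24 * 'C(n, 4)]. *)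
Lemma tau_starE (R : realType) n (X Y : 'I_n -> R) : (5 <= n)%N ->
  let p := induced_perm X Y in
  let n4 : int := n%:Z * (n%:Z - 1) * (n%:Z - 2) * (n%:Z - 3) in
  (36 * (\sum_(i < n) tau_term p i) - 4 * n4)%:~R / (3 * n4)%:~R = tau_star X Y.
Proof.
move=> n5 p n4.
have bin4 : 24 * 'C(n, 4)%:Z = n4.
  have := bin_ffact n 4; rewrite !ffactnS ffactn0 muln1 => h.
  have -> : 24 * 'C(n, 4)%:Z = ('C(n, 4) * 4`!)%N by rewrite mulrC PoszM.
  rewrite h /n4; have -> : n = (n - 4 + 4)%N by lia.
  by rewrite !addnS addn0 /= !PoszM; lia.
have nc := concordant_quadsE p; rewrite quadsE in nc.
rewrite /tau_star /Tstat -/p.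
set A := \sum_(s in setC4) _; set B := \sum_(s in setD4) _.
have hA : A = (concordant_quads p)%:~R.
  by rewrite -(sum_occurrencesC R) /A -natr_sum.
have hAB : A + B = 'C(n, 4)%:R.
  by rewrite -(sum_occurrences_all R p) natrD /A /B !natr_sum.
have -> : B = 'C(n, 4)%:R - A by rewrite -hAB addrC addKr.
have -> : \sum_(i < n) tau_term p i = 2 * concordant_quads p + 2 * 'C(n, 4)%:Z.
  by rewrite nc subrK.
have C0 : 'C(n, 4)%:R != 0 :> R by rewrite pnatr_eq0 -lt0n bin_gt0 ltnW.
rewrite -bin4 hA !(rmorphM, rmorphB, rmorphD) /= -!pmulrn.
by field.
Qed.

(** * The statistic R *)

Section Hoeffding.
Variables (n : nat) (p : 'S_n).
Implicit Types (i j k l m : 'I_n).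

Lemma sum_notin (s : seq 'I_n) (F : 'I_n -> int) : uniq s ->
  \sum_(k < n) chi (k \notin s) * F k = \sum_(k < n) F k - \sum_(k <- s) F k.
Proof.
move=> us; rewrite (big_uniq _ us) /=.
rewrite [X in _ = X - _](bigID (mem s)) /= addrAC subrr add0r [RHS]big_mkcond.
by apply: eq_bigr => k _; case: (k \in s); rewrite ?mul0r ?mul1r.
Qed.

Lemma sum_const (c : int) : \sum_(k < n) c = c * n%:Z.
Proof. by rewrite sumr_const card_ord -mulr_natr natz. Qed.

Lemma sum_offdiag (F : 'I_n -> 'I_n -> int) :
  \sum_(l < n) \sum_(m < n) chi (l != m) * F l m =
  \sum_(l < n) \sum_(m < n) F l m - \sum_(l < n) F l l.
Proof.
rewrite -sumrB; apply: eq_bigr => l _; rewrite -(sum_diag l (F l)) -sumrB.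
by apply: eq_bigr => m _; case: eqP; rewrite ?mul0r ?mul1r ?subrr ?subr0.
Qed.

Definition corner l m : int := \sum_(i < n) chi ((i < l)%N && (p i < p m)%N).

Definition kernel i j k l m : int :=
  chi ((i < l)%N && (p i < p m)%N) * chi ((j < l)%N && (p j < p m)%N)
  - 2 * chi ((i < l)%N && (p i < p m)%N) * chi (j < l)%N * chi (p k < p m)%N.

Definition uniq5 i j k l m : bool := uniq [:: i; j; k; l; m].

(** The points are removed one at a time, with [l] and [m] chosen first, so that the sums over [k],
    [j], [i] can be evaluated successively. *)
Lemma uniq5E i j k l m : chi (uniq5 i j k l m) =
  chi (l != m) * (chi (i \notin [:: l; m]) *
    (chi (j \notin [:: i; l; m]) * chi (k \notin [:: j; i; l; m]))).
Proof.
have -> : uniq5 i j k l m = uniq [:: k; j; i; l; m].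
  by apply: perm_uniq; apply/seq.permP => a /=; lia.
rewrite -!chiM 3!cons_uniq; congr chi.
rewrite [uniq [:: l; m]]/= andbT mem_seq1.
by case: (l == m); case: (i \notin [:: l; m]); case: (j \notin [:: i; l; m]);
  case: (k \notin [:: j; i; l; m]).
Qed.

(* Without [l] and [m] there are [l - chi (m < l)] positions below [l] and
   [p m - chi (p l < p m)] points with value below [p m]; the further [- 1]
   excludes the point [i], which is below both thresholds. *)
Lemma sum_kernel l m : l != m ->
  \sum_(i < n) \sum_(j < n) \sum_(k < n) chi (uniq5 i j k l m) * kernel i j k l m =
  (n%:Z - 2) * (corner l m * (corner l m - 1))
  - 2 * (corner l m * (l%:Z - chi (m < l)%N - 1) * ((p m)%:Z - chi (p l < p m)%N - 1)).
Proof.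
move=> lm; pose e i := chi ((i < l)%N && (p i < p m)%N).
set c := corner l m; set x := l%:Z - _ - 1; set y := (p m)%:Z - _ - 1.
transitivity (\sum_(i < n) e i * ((n%:Z - 2) * (c - 1) - 2 * x * y)); last first.
  by rewrite -mulr_suml -[\sum_(i < n) e i]/c; ring.
have el : e l = 0 by rewrite /e ltnn.
have em : e m = 0 by rewrite /e ltnn andbF.
have eAB j : chi (j < l)%N * chi (p j < p m)%N = e j by rewrite -chiM.
apply: eq_bigr => i _.
have [ei0|ei1] : e i = 0 \/ e i = 1 by rewrite /e; case: (_ && _); [right|left].
  rewrite ei0 mul0r big1 // => j _; rewrite big1 // => k _.
  by rewrite /kernel -/(e i) ei0; ring.
have [il pim] : (i < l)%N /\ (p i < p m)%N by move: ei1; rewrite /e; case: (i < l)%N; case: (p i < p m)%N.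
have i_lm : i \notin [:: l; m].
  rewrite !inE; apply/norP; split; apply/eqP => E; move: ei1; rewrite E ?el ?em //.
have u3 : uniq [:: i; l; m] by rewrite /= i_lm inE lm.
(* Result of the sum over [k], which avoids four points; excluding [j] turns
   [chi (j < l) * chi (p j < p m)] into [e j]. *)
transitivity (\sum_(j < n) chi (j \notin [:: i; l; m]) *
    ((n%:Z - 4) * e j - 2 * (chi (j < l)%N * ((p m)%:Z - 1 - chi (p l < p m)%N) - e j))).
  apply: eq_bigr => j _.
  have [jn|jn] := boolP (j \notin [:: i; l; m]); last first.
    rewrite mul0r big1 // => k _.
    by rewrite uniq5E (negPf jn) !(mul0r, mulr0).
  have u4 : uniq [:: j; i; l; m].
    by rewrite cons_uniq jn.
  rewrite mul1r.
  transitivity (\sum_(k < n) chi (k \notin [:: j; i; l; m]) *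
     (e j - 2 * chi (j < l)%N * chi (p k < p m)%N)).
    apply: eq_bigr => k _; rewrite uniq5E jn i_lm lm !mul1r /kernel -/(e i) -/(e j) ei1.
    by ring.
  rewrite sum_notin // sumrB -mulr_sumr sum_plt_l sum_const.
  rewrite !big_cons big_nil pim ltnn -(eAB j) /chi /=; ring.
rewrite sum_notin // sumrB -!mulr_sumr sumrB -mulr_suml sum_lt_l -[\sum_(i < n) e i]/c.
rewrite !big_cons big_nil el em ei1 il ltnn /x /y /chi /=; ring.
Qed.

Definition sum5 (K : 'I_n -> 'I_n -> 'I_n -> 'I_n -> 'I_n -> int) : int :=
  \sum_(i < n) \sum_(j < n) \sum_(k < n) \sum_(l < n) \sum_(m < n)
    chi (uniq5 i j k l m) * K i j k l m.

Lemma sum5E K (S : 'I_n -> 'I_n -> int) :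
  (forall l m, l != m -> \sum_(i < n) \sum_(j < n) \sum_(k < n)
     chi (uniq5 i j k l m) * K i j k l m = S l m) ->
  sum5 K = \sum_(l < n) \sum_(m < n) chi (l != m) * S l m.
Proof.
move=> KS; rewrite /sum5.
under eq_bigr do under eq_bigr do rewrite exchange_big /=.
under eq_bigr do rewrite exchange_big /=.
rewrite exchange_big /=; apply: eq_bigr => l _.
under eq_bigr do under eq_bigr do rewrite exchange_big /=.
under eq_bigr do rewrite exchange_big /=.
rewrite exchange_big /=; apply: eq_bigr => m _.
have [lm|lm] := boolP (l != m); first by rewrite mul1r KS.
rewrite mul0r big1 // => i _; rewrite big1 // => j _; rewrite big1 // => k _.
by rewrite uniq5E (negPf lm) !mul0r.
Qed.

Lemma sum5_one : sum5 (fun _ _ _ _ _ => 1) =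
  n%:Z * (n%:Z - 1) * (n%:Z - 2) * (n%:Z - 3) * (n%:Z - 4).
Proof.
have notin (s : seq 'I_n) : uniq s -> \sum_(k < n) chi (k \notin s) = n%:Z - (size s)%:Z.
  move=> us; have := sum_notin (fun=> 1) us; rewrite !sumr_const card_ord natz.
  rewrite big_const_seq count_predT iter_addr_0 natz.
  by under eq_bigr do rewrite mulr1.
rewrite (sum5E (S := fun _ _ => (n%:Z - 2) * (n%:Z - 3) * (n%:Z - 4))); last first.
  move=> l m lm.
  transitivity (\sum_(i < n) chi (i \notin [:: l; m]) * ((n%:Z - 3) * (n%:Z - 4))).
    apply: eq_bigr => i _; have [ilm|ilm] := boolP (i \notin _); last first.
      rewrite mul0r big1 // => j _; rewrite big1 // => k _.
      by rewrite uniq5E (negPf ilm) !(mul0r, mulr0).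
    have u3 : uniq [:: i; l; m] by rewrite cons_uniq ilm /= inE lm.
    rewrite mul1r -(notin _ u3) mulr_suml; apply: eq_bigr => j _.
    have [jn|jn] := boolP (j \notin _); last first.
      by rewrite mul0r big1 // => k _; rewrite uniq5E (negPf jn) !(mul0r, mulr0).
    have u4 : uniq [:: j; i; l; m] by rewrite cons_uniq jn.
    rewrite mul1r -(notin _ u4); apply: eq_bigr => k _.
    by rewrite uniq5E lm ilm jn !mul1r mulr1.
  by rewrite -mulr_suml notin ?mulrA //= inE lm.
by rewrite sum_offdiag !sum_const; ring.
Qed.

(** * Sums of corner counts *)

Lemma corner_diag l : corner l l = lower p l.
Proof. by apply: eq_bigr => i _; rewrite andbC. Qed.

(** Both sides count a pair of positions below [l] together with a value [p m] above both of its
    values: the left by ordered pairs, [high_pairs] by the later position of the pair. *)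
Lemma corner_pairs : \sum_(l < n) \sum_(m < n) corner l m * (corner l m - 1) =
  2 * high_pairs p.
Proof.
rewrite high_pairs_sum4 -sum4_swap34 -sum4_swap23 /sum4 mulr_sumr.
apply: eq_bigr => l _; rewrite mulr_sumr; apply: eq_bigr => m _.
rewrite -(pairs_lt (fun i => (i < l)%N && (p i < p m)%N)); congr (2 * _).
apply: eq_bigr => i _; apply: eq_bigr => j _; congr chi.
case: (ltnP i j) => ij; rewrite ?andbF //=; case: (ltnP j l) => jl; rewrite ?andbF //=.
by rewrite (ltn_trans ij jl) /= andbT.
Qed.

Lemma sum_lt_r_val i :
  2 * (\sum_(l < n) chi (i < l)%N * (l%:Z - 1)) =
  (n%:Z - 1) * (n%:Z - 2) - i%:Z * (i%:Z - 1).
Proof.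
have tot : 2 * (\sum_(l < n) l%:Z) = n%:Z * n%:Z - n%:Z.
  under eq_bigr do rewrite -sum_lt_l; rewrite sum_sym2.
  transitivity (\sum_(l < n) \sum_(m < n) (1 - chi (l == m) * 1)).
    by apply: eq_bigr => l _; apply: eq_bigr => m _; rewrite mulr1 /chi -val_eqE /=; lia.
  under eq_bigr do rewrite sumrB sum_diag sum_one.
  by rewrite sumrB sum_one sum_const.
transitivity (2 * (\sum_(l < n) l%:Z) - 2 * (\sum_(l < n) chi (l < i)%N * l%:Z)
   - 2 * (\sum_(l < n) chi (i == l) * l%:Z) - 2 * (\sum_(l < n) chi (i < l)%N)).
  rewrite -!mulrBr -!sumrB; congr (2 * _); apply: eq_bigr => l _.
  by rewrite /chi -val_eqE /=; case: ltngtP => /=; lia.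
by rewrite tot sum_val_lt sum_diag sum_lt_r; ring.
Qed.

Lemma sum_plt_r_val i :
  2 * (\sum_(m < n) chi (p i < p m)%N * ((p m)%:Z - 1)) =
  (n%:Z - 1) * (n%:Z - 2) - (p i)%:Z * ((p i)%:Z - 1).
Proof.
by rewrite -sum_lt_r_val [in RHS](reindex_inj (h := p)) //; exact: perm_inj.
Qed.

(** For a fixed point [i] of the corner, the conditions on [l] and [m] are independent and the
    double sum factors. *)
Lemma corner_sum1 :
  4 * (\sum_(l < n) \sum_(m < n) corner l m * (l%:Z - 1) * ((p m)%:Z - 1)) =
  \sum_(i < n) ((n%:Z - 1) * (n%:Z - 2) - i%:Z * (i%:Z - 1)) *
               ((n%:Z - 1) * (n%:Z - 2) - (p i)%:Z * ((p i)%:Z - 1)).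
Proof.
transitivity (4 * (\sum_(i < n) (\sum_(l < n) chi (i < l)%N * (l%:Z - 1)) *
    (\sum_(m < n) chi (p i < p m)%N * ((p m)%:Z - 1)))); last first.
  by rewrite mulr_sumr; apply: eq_bigr => i _; rewrite -sum_lt_r_val -sum_plt_r_val; ring.
congr (4 * _); under [RHS]eq_bigr do rewrite mulr_suml.
rewrite [RHS]exchange_big; apply: eq_bigr => l _ /=.
under [RHS]eq_bigr do rewrite mulr_sumr.
rewrite [RHS]exchange_big; apply: eq_bigr => m _ /=.
by rewrite !mulr_suml; apply: eq_bigr => i _; rewrite chiM; ring.
Qed.

(** For fixed [i] and [m], the admissible [l] are the positions after the later of the two. Renaming
    that later position [i] in both cases gives the common factor [n - 1 - i]. *)
Lemma corner_sum2 :
  \sum_(l < n) \sum_(m < n) corner l m * chi (m < l)%N * ((p m)%:Z - 1) =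
  \sum_(i < n) (n%:Z - 1 - i%:Z) * (((p i)%:Z - 1) * lower p i
    + prefix_sum p i - lower_sum p i - i%:Z + lower p i).
Proof.
transitivity (\sum_(m < n) \sum_(i < n) chi (p i < p m)%N * ((p m)%:Z - 1) *
    (chi (i < m)%N * (n%:Z - 1 - m%:Z) + chi (m < i)%N * (n%:Z - 1 - i%:Z))).
  rewrite exchange_big; apply: eq_bigr => m _ /=.
  under eq_bigr do rewrite -mulrA mulr_suml.
  rewrite exchange_big; apply: eq_bigr => i _ /=.
  have [->|im] := eqVneq i m.
    by rewrite !ltnn big1 => [|l _]; rewrite ?andbF /chi /= !mul0r.
  have nim : (i : nat) != m by rewrite val_eqE.
  rewrite -!sum_lt_r !mulr_sumr -big_split mulr_sumr; apply: eq_bigr => l _ /=.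
  have <- : chi (i < l)%N * chi (m < l)%N =
      chi (i < m)%N * chi (m < l)%N + chi (m < i)%N * chi (i < l)%N.
    by rewrite -!chiM /chi; lia.
  by rewrite chiM; ring.
under eq_bigr do under eq_bigr do rewrite mulrDr.
under eq_bigr do rewrite big_split; rewrite big_split /=.
rewrite [X in _ + X]exchange_big -big_split; apply: eq_bigr => i _ /=.
have -> : \sum_(m < n) chi (p m < p i)%N * ((p i)%:Z - 1) * (chi (m < i)%N * (n%:Z - 1 - i%:Z))
   = (n%:Z - 1 - i%:Z) * (((p i)%:Z - 1) * lower p i).
  by rewrite /lower !mulr_sumr; apply: eq_bigr => m _; rewrite chiM; ring.
have second (c : int) :
    \sum_(m < n) chi (p i < p m)%N * ((p m)%:Z - 1) * (chi (m < i)%N * c) =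
    c * (prefix_sum p i - lower_sum p i - i%:Z + lower p i).
  rewrite -(sum_lt_l i) /prefix_sum /lower_sum /lower.
  rewrite -!sumrB -big_split mulr_sumr /=.
  apply: eq_bigr => m _; have := p_eq p i m.
  rewrite /chi; case: (ltnP m i) => mi; case: (ltngtP (p m) (p i)) => //= pmi; lia.
by rewrite second; ring.
Qed.

Lemma corner_sum3 :
  \sum_(l < n) \sum_(m < n) corner l m * (l%:Z - 1) * chi (p l < p m)%N =
  \sum_(l < n) (l%:Z - 1) * left_max p l.
Proof.
apply: eq_bigr => l _; rewrite /left_max mulr_sumr.
under eq_bigr do rewrite -mulrA mulr_suml.
rewrite exchange_big; apply: eq_bigr => i _ /=; rewrite !mulr_sumr.
by apply: eq_bigr => m _; rewrite !chiM; ring.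
Qed.

(** For fixed [l] this counts pairs of positions before [l] whose larger value exceeds [p l]: all
    pairs except those with both values below [p l]. *)
Lemma corner_sum4 :
  2 * (\sum_(l < n) \sum_(m < n) corner l m * chi (m < l)%N * chi (p l < p m)%N) =
  \sum_(l < n) (l%:Z * (l%:Z - 1) - lower p l * (lower p l - 1)).
Proof.
rewrite mulr_sumr; apply: eq_bigr => l _.
under eq_bigr do rewrite -mulrA mulr_suml.
rewrite sum_sym2.
have sq (u : 'I_n -> int) : (forall m, u m * u m = u m) ->
    (\sum_(m < n) u m) * (\sum_(m < n) u m - 1) =
    \sum_(m < n) \sum_(i < n) (u m * u i - chi (m == i) * u i).
  move=> uu; under [RHS]eq_bigr do rewrite sumrB sum_diag -mulr_sumr.
  by rewrite sumrB -mulr_suml mulrBr mulr1.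
rewrite -sum_lt_l /lower !sq; try by move=> m; rewrite -chiM andbb.
rewrite -sumrB; apply: eq_bigr => m _; rewrite -sumrB; apply: eq_bigr => i _.
have := p_eq p m i; have := p_eq p m l; have := p_eq p i l.
rewrite -!chiM /chi -val_eqE /=.
case: (ltnP i l) => il; case: (ltnP m l) => ml /=; rewrite ?andbF //=; lia.
Qed.

(** [H] is [left_max p i]. The lines collect [corner_pairs] and the four corner sums; the term
    [L * (L - 1)] in the first and the product [4 * L * (i - 1) * (y - 1)] in the second remove the
    diagonal [l = m]. *)
Definition hoeffding_term i : int :=
  let N := (n%:Z - 1) * (n%:Z - 2) in
  let y := (p i)%:Z in
  let L := lower p i in
  let P := prefix_sum p i in
  let S := lower_sum p i in
  let H := L * (n%:Z - 1 - y) + (n%:Z - 1) * (i%:Z - L) - P + S in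
  2 * (n%:Z - 2) * (2 * (n%:Z - 1 - i%:Z) * H - L * (L - 1))
  - ((N - i%:Z * (i%:Z - 1)) * (N - y * (y - 1)) - 4 * L * (i%:Z - 1) * (y - 1))
  + 4 * (n%:Z - 1 - i%:Z) * ((y - 1) * L + P - S - i%:Z + L)
  + 4 * (i%:Z - 1) * H - 2 * (i%:Z * (i%:Z - 1) - L * (L - 1)).

Lemma sum5_kernel : 2 * sum5 kernel = \sum_(i < n) hoeffding_term i.
Proof.
pose Z l m := corner l m * (l%:Z - chi (m < l)%N - 1) * ((p m)%:Z - chi (p l < p m)%N - 1).
rewrite (sum5E (S := fun l m => (n%:Z - 2) * (corner l m * (corner l m - 1)) - 2 * Z l m));
  last exact: sum_kernel.
rewrite sum_offdiag; under eq_bigr do rewrite sumrB -!mulr_sumr.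
rewrite sumrB -!mulr_sumr corner_pairs.
have -> : \sum_(l < n) \sum_(m < n) Z l m =
   \sum_(l < n) \sum_(m < n) corner l m * (l%:Z - 1) * ((p m)%:Z - 1)
   - \sum_(l < n) \sum_(m < n) corner l m * chi (m < l)%N * ((p m)%:Z - 1)
   - \sum_(l < n) \sum_(m < n) corner l m * (l%:Z - 1) * chi (p l < p m)%N
   + \sum_(l < n) \sum_(m < n) corner l m * chi (m < l)%N * chi (p l < p m)%N.
  rewrite -!sumrB -big_split; apply: eq_bigr => l _; rewrite -!sumrB -big_split.
  by apply: eq_bigr => m _; rewrite /Z /=; ring.
have lin (h a b c d e : int) :
  2 * ((n%:Z - 2) * (2 * h) - 2 * (a - b - c + d) - e) =
  4 * (n%:Z - 2) * h - 4 * a + 4 * b + 4 * c - 2 * (2 * d) - 2 * e by ring.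
rewrite lin corner_sum1 corner_sum2 corner_sum3 corner_sum4.
rewrite /high_pairs !mulr_sumr -sumrB -!big_split -!sumrB /=.
apply: eq_bigr => i _; rewrite /Z corner_diag !ltnn /hoeffding_term left_maxE /chi /=; ring.
Qed.


End Hoeffding.

Lemma psiE (R : realType) n (p : 'S_n) (x y : 'I_n -> R) :
  (forall i j, (x i < x j) = (i < j)%N) -> (forall i j, (y i < y j) = (p i < p j)%N) ->
  forall i j k l m, psi (x i, y i) (x j, y j) (x k, y k) (x l, y l) (x m, y m) =
    (kernel p i j k l m)%:~R + 9^-1.
Proof.
move=> hx hy i j k l m; rewrite /psi /ind !hx !hy /kernel; congr (_ + _).
by rewrite rmorphB !rmorphM /= -!pmulrn.
Qed.

(** Twice the sum of [kernel] over distinct quintuples is the sum of the terms, and there are [n5]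
    quintuples, so the fraction is the average of [kernel] plus 1/9. *)
Lemma RstatE (R : realType) n (X Y : 'I_n -> R) : injective X -> injective Y -> (5 <= n)%N ->
  let p := induced_perm X Y in
  let n5 : int := n%:Z * (n%:Z - 1) * (n%:Z - 2) * (n%:Z - 3) * (n%:Z - 4) in
  (9 * (\sum_(i < n) hoeffding_term p i) + 2 * n5)%:~R / (18 * n5)%:~R = Rstat X Y.
Proof.
move=> injX injY n_ge5 p n5.
pose g : 'I_n -> 'I_n := point_of injX; have injg : injective g := point_of_inj (injX := injX).
rewrite /Rstat; set S := \sum_(i < n) _.
have -> : S = \sum_(i < n) \sum_(j < n) \sum_(k < n) \sum_(l < n) \sum_(m < n)
    ((chi (uniq5 i j k l m) * kernel p i j k l m)%:~R + (chi (uniq5 i j k l m))%:~R * 9^-1).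
  rewrite /S.
  (* The statistic does not depend on the labelling of the points, which are renamed by their rank
     in abscissa. *)
  rewrite (reindex_inj injg); apply: eq_bigr => i _.
  rewrite (reindex_inj injg); apply: eq_bigr => j _.
  rewrite (reindex_inj injg); apply: eq_bigr => k _.
  rewrite (reindex_inj injg); apply: eq_bigr => l _.
  rewrite big_mkcond (reindex_inj injg); apply: eq_bigr => m _.
  have -> : uniq [:: g i; g j; g k; g l; g m] = uniq5 i j k l m.
    exact: (map_inj_uniq injg [:: i; j; k; l; m]).
  rewrite (psiE (ltX_point_of injX) (ltY_point_of injX injY)).
  by case: uniq5; rewrite /chi /= ?mul1r ?mul0r ?addr0.
have -> : \sum_(i < n) \sum_(j < n) \sum_(k < n) \sum_(l < n) \sum_(m < n)
    ((chi (uniq5 i j k l m) * kernel p i j k l m)%:~R + (chi (uniq5 i j k l m))%:~R * 9^-1) =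
    (sum5 (kernel p))%:~R + (sum5 (fun _ _ _ _ _ : 'I_n => 1))%:~R * 9^-1 :> R.
  rewrite /sum5.
  do 5 (rewrite !rmorph_sum mulr_suml -big_split; apply: eq_bigr => ? _ /=).
  by rewrite mulr1.
rewrite sum5_one -sum5_kernel -/n5.
have n5E : n5 = (n * (n - 1) * (n - 2) * (n - 3) * (n - 4))%N.
  by rewrite !PoszM /n5 -!subzn //; lia.
have n50 : n5%:~R != 0 :> R.
  by rewrite intr_eq0 n5E; apply/eqP => -[] /eqP; rewrite !muln_eq0; lia.
have -> : (n * (n - 1) * (n - 2) * (n - 3) * (n - 4))%N%:R = n5%:~R :> R.
  by rewrite n5E -pmulrn.
move: n5 (sum5 _) n50 {n5E} => N K N0.
by rewrite !(rmorphM, rmorphD) /=; field.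
Qed.

(** * The algorithms *)

(** Repeats [tau_term] node for node, so that its value agrees with the summand by computation once
    the variables and array entries are known. *)
Definition tau_term_expr : expr :=
  let n := Size in let x := Var 2 in let y := Get 4 x in
  let L := Get 2 x in let S := Get 3 x in let P := Var 14 in
  let U := n -' Const 1 -' x -' y +' L in
  let H := L *' (n -' Const 1 -' y) +' (n -' Const 1) *' (x -' L) -' P +' S in
  x *' (x -' Const 1) *' U
  -' L *' ((n -' Const 2) *' (n -' Const 3)
           -' (n -' Const 1 -' x) *' (n -' Const 2 -' x))
  +' x *' (Const 2 *' y *' U +' y *' (y -' Const 1) -' Const 2 *' S)
  +' (x -' Const 1) *' U *' (U -' Const 1)
  +' (n -' Const 2 -' x) *' L *' (L -' Const 1)
  +' Const 2 *' (n -' Const 1 -' x) *' H.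

Definition falling4_expr : expr :=
  Size *' (Size -' Const 1) *' (Size -' Const 2) *' (Size -' Const 3).

Definition tau_num : expr := Const 36 *' Var 12 -' Const 4 *' falling4_expr.
Definition tau_den : expr := Const 3 *' falling4_expr.

Definition hoeffding_term_expr : expr :=
  let n := Size in let x := Var 2 in let y := Get 4 x in
  let L := Get 2 x in let S := Get 3 x in let P := Var 14 in
  let N := (n -' Const 1) *' (n -' Const 2) in
  let H := L *' (n -' Const 1 -' y) +' (n -' Const 1) *' (x -' L) -' P +' S in
  Const 2 *' (n -' Const 2) *'
    (Const 2 *' (n -' Const 1 -' x) *' H -' L *' (L -' Const 1))
  -' ((N -' x *' (x -' Const 1)) *' (N -' y *' (y -' Const 1))
      -' Const 4 *' L *' (x -' Const 1) *' (y -' Const 1))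
  +' Const 4 *' (n -' Const 1 -' x) *' ((y -' Const 1) *' L +' P -' S -' x +' L)
  +' Const 4 *' (x -' Const 1) *' H
  -' Const 2 *' (x *' (x -' Const 1) -' L *' (L -' Const 1)).

Definition falling5_expr : expr := falling4_expr *' (Size -' Const 4).

Definition hoeffding_num : expr := Const 9 *' Var 12 +' Const 2 *' falling5_expr.
Definition hoeffding_den : expr := Const 18 *' falling5_expr.

Section Bridge.
Variables (R : realType) (n : nat) (X Y : 'I_n -> R).
Local Notation pi := (induced_perm X Y).

Lemma lower_leftE i : (lower_left X Y i)%:Z = lower pi i.
Proof.
rewrite /lower_left big_mkcond (big_morph Posz PoszD (erefl _)).
by apply: eq_bigr => j _; rewrite /chi; case: ifP.
Qed.

Lemma lower_left_sumE i : (lower_left_sum X Y i)%:Z = lower_sum pi i.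
Proof.
rewrite /lower_left_sum big_mkcond (big_morph Posz PoszD (erefl _)).
by apply: eq_bigr => j _; rewrite /chi; case: ifP; rewrite ?mul1r ?mul0r.
Qed.

Lemma prefix_sumE (i : 'I_n) : (\sum_(j < n | (j < i)%N) pi j)%N%:Z = prefix_sum pi i.
Proof.
rewrite big_mkcond (big_morph Posz PoszD (erefl _)).
by apply: eq_bigr => j _; rewrite /chi; case: ifP; rewrite ?mul1r ?mul0r.
Qed.

End Bridge.

(** With [l = trunc_log 2 n] at least 1, [n < 2 ^ (l + 1) <= 2 ^ (2 * l)]; the 200th power gives the
    400. *)
Lemma word_size n d : (5 <= n)%N -> (d <= 200)%N -> (n ^ d < 2 ^ (400 * trunc_log 2 n))%N.
Proof.
move=> n5 d200.
apply: (@leq_ltn_trans (n ^ 200)); first by rewrite leq_pexp2l // (leq_trans _ n5).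
have l1 : (1 <= trunc_log 2 n)%N by rewrite trunc_log_gt0 (leq_trans _ n5).
rewrite (_ : 400 * _ = (2 * trunc_log 2 n) * 200)%N; last by rewrite mulnAC.
rewrite expnM ltn_exp2r //.
apply: leq_trans (trunc_log_ltn n (ltnSn 1)) _.
by rewrite leq_exp2l // mul2n -addnn -addn1 leq_add2l.
Qed.

Lemma program_time c n : (5 <= n)%N ->
  (c * (n * (trunc_log 2 n).+1) <= 2 * c * (n * trunc_log 2 n))%N.
Proof.
move=> n5; have l1 : (1 <= trunc_log 2 n)%N by rewrite trunc_log_gt0 (leq_trans _ n5).
rewrite [(2 * c)%N]mulnC -mulnA leq_mul2l mulnCA leq_mul2l.
by rewrite mul2n -addnn -addn1 leq_add2l l1 !orbT.
Qed.

Theorem mainTheorem2 (R : realType) :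
  exists (Ptau PR : cmd) (K c : nat),
    forall (n : nat) (X Y : 'I_n -> R),
      (5 <= n)%N -> injective X -> injective Y ->
      computes_within (K * trunc_log 2 n) (c * (n * trunc_log 2 n)) X Y
        Ptau (tau_star X Y) /\
      computes_within (K * trunc_log 2 n) (c * (n * trunc_log 2 n)) X Y
        PR (Rstat X Y).
Proof.
pose ct := program_cost tau_term_expr tau_num tau_den.
pose cR := program_cost hoeffding_term_expr hoeffding_num hoeffding_den.
exists (program tau_term_expr tau_num tau_den).
exists (program hoeffding_term_expr hoeffding_num hoeffding_den).
exists 400%N, (2 * (ct + cR))%N => n X Y n5 injX injY.
have n_gt1 : (1 < n)%N by exact: leq_trans n5.
have small := word_size n5.
have le_time c : (c <= ct + cR)%N -> (c * (n * (trunc_log 2 n).+1) <=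
    2 * (ct + cR) * (n * trunc_log 2 n))%N.
  move=> hc; apply: leq_trans (program_time _ n5).
  by rewrite leq_mul2r hc orbT.
pose p := induced_perm X Y.
pose n4 : int := n%:Z * (n%:Z - 1) * (n%:Z - 2) * (n%:Z - 3).
have n4_neq0 : n4 != 0 by rewrite !mulf_neq0 //; lia.
have n5_neq0 : n4 * (n%:Z - 4) != 0 by rewrite mulf_neq0 //; lia.
split.
(* The three [isT] check the exponents of the term, the accumulation and the output by computation;
   the constant function checks that no expression can fail. *)
- have [||t [s [x ht [v0 v1]]]] := @terminates_program _ _ X Y n_gt1 injX injY _ small
    tau_term_expr tau_num tau_den isT isT isT (fun=> isT) (tau_term p)
    (36 * (\sum_(i < n) tau_term p i) - 4 * n4) (3 * n4) _ _ (fun=> erefl).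
  + move=> s i v2 a4 a2 a3 v14.
    by rewrite /= v2 a4 a2 a3 v14 lower_leftE lower_left_sumE prefix_sumE.
  + by move=> s v12; rewrite /= v12.
  exists t, s; split=> //; first by apply: leq_trans ht (le_time _ _); exact: leq_addr.
    by rewrite v1 mulf_neq0.
  by rewrite v0 v1; exact: tau_starE.
- have [||t [s [x ht [v0 v1]]]] := @terminates_program _ _ X Y n_gt1 injX injY _ small
    hoeffding_term_expr hoeffding_num hoeffding_den isT isT isT (fun=> isT) (hoeffding_term p)
    (9 * (\sum_(i < n) hoeffding_term p i) + 2 * (n4 * (n%:Z - 4)))
    (18 * (n4 * (n%:Z - 4))) _ _ (fun=> erefl).
  + move=> s i v2 a4 a2 a3 v14.
    by rewrite /= v2 a4 a2 a3 v14 lower_leftE lower_left_sumE prefix_sumE.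
  + by move=> s v12; rewrite /= v12.
  exists t, s; split=> //; first by apply: leq_trans ht (le_time _ _); exact: leq_addl.
    by rewrite v1 mulf_neq0.
  by rewrite v0 v1; exact: RstatE.
Qed.
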